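(* Let $n\ge 3$. There exist a field $F\equiv\mathbb{Q}$ and a 2-cocycle $f\in S^2((F^\times)^{n-1},F^\times)$ such that $\mathrm{T}_n(F,f)\equiv \mathrm{T}_n(\mathbb{Q})$, but $\mathrm{T}_n(F,f)\not\cong \mathrm{T}_n(L)$ for any field $L$.
   Context: $\equiv$ denotes elementary equivalence (language of groups for groups, language of rings for fields). $\mathrm{T}_n(F)$ is the group of invertible upper triangular $n\times n$ matrices over $F$, $\mathrm{UT}_n(F)$ the group of upper unitriangular matrices. $d_i(\alpha)$ is the diagonal matrix with $\alpha$ in position $i$ and $1$ elsewhere; $B_n(F)=\prod_{i=1}^{n-1}d_i(F^\times)$ is identified with $(F^\times)^{n-1}$. For abelian groups $B,Z$, $S^2(B,Z)$ is the group of symmetric 2-cocycles: functions $f:B\times B\to Z$ with $f(xy,z)f(x,y)=f(x,yz)f(y,z)$, $f(1,x)=f(x,1)=1$, $f(x,y)=f(y,x)$. For $f\in S^2(B_n(F),F^\times)$, $\mathrm{T}_n(F,f)$ (also written $\mathrm{T}_n(F,f,F^\times)$) is the group on the set $\mathrm{UT}_n(F)\times F^\times\times B_n(F)$ with product $$(u_1,(z_1,b_1))(u_2,(z_2,b_2))=(u_1\cdot b_1u_2b_1^{-1},(z_1z_2f(b_1,b_2),b_1b_2)).$$ *)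

(* Defs.v *)
From HB Require Import structures.
From mathcomp Require Import all_boot all_order all_algebra.

Set Implicit Arguments.
Unset Strict Implicit.
Unset Printing Implicit Defensive.

Import GRing.Theory.

Local Open Scope ring_scope.

(* Only function symbols are needed for groups and rings. *)
Record language : Type := Language {
  symbol : Type;
  arity : symbol -> nat
}.

Record model (L : language) : Type := Model {
  carrier :> Type;
  interp : forall s : symbol L, ('I_(arity s) -> carrier) -> carrier
}.

Inductive term (L : language) : Type :=
| Var of nat
| App (s : symbol L) of ('I_(arity s) -> term L).

(* The other connectives and the universal quantifier are the usual classical
   abbreviations. *)
Inductive formula (L : language) : Type :=
| Equal of term L & term L
| Not of formula L
| And of formula L & formula L
| Exists of nat & formula L.

Fixpoint eval (L : language) (M : model L) (e : nat -> M) (t : term L) : M :=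
  match t with
  | Var x => e x
  | App s ts => @interp L M s (fun i => eval e (ts i))
  end.

Definition update (T : Type) (e : nat -> T) (x : nat) (a : T) : nat -> T :=
  fun y => if y == x then a else e y.

Fixpoint holds (L : language) (M : model L) (e : nat -> M) (p : formula L) :
    Prop :=
  match p with
  | Equal t u => eval e t = eval e u
  | Not q => ~ holds e q
  | And q r => holds e q /\ holds e r
  | Exists x q => exists a : M, holds (update e x a) q
  end.

Fixpoint occurs (L : language) (x : nat) (t : term L) : Prop :=
  match t with
  | Var y => x = y
  | App s ts => exists i, occurs x (ts i)
  end.

Fixpoint free (L : language) (x : nat) (p : formula L) : Prop :=
  match p with
  | Equal t u => occurs x t \/ occurs x u
  | Not q => free x q
  | And q r => free x q \/ free x r
  | Exists y q => x <> y /\ free x q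
  end.

Definition sentence (L : language) (p : formula L) : Prop :=
  forall x, ~ free x p.

Definition satisfies (L : language) (M : model L) (p : formula L) : Prop :=
  forall e : nat -> M, holds e p.

Definition elem_equiv (L : language) (M N : model L) : Prop :=
  forall p : formula L, sentence p -> (satisfies M p <-> satisfies N p).

Inductive group_symbol : Type := GOne | GInv | GMul.

Definition group_language : language :=
  Language (fun s => match s with GOne => 0 | GInv => 1 | GMul => 2 end)%N.

Definition group_model (G : groupType) : model group_language :=
  @Model group_language G (fun s =>
    match s return ('I_(@arity group_language s) -> G) -> G with
    | GOne => fun=> 1%g
    | GInv => fun a => (a ord0)^-1%g
    | GMul => fun a => (a ord0 * a ord_max)%g
    end).

Inductive ring_symbol : Type := RZero | ROne | ROpp | RAdd | RMul.

Definition ring_language : language :=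
  Language (fun s =>
    match s with RZero | ROne => 0 | ROpp => 1 | RAdd | RMul => 2 end)%N.

Definition ring_model (R : nzRingType) : model ring_language :=
  @Model ring_language R (fun s =>
    match s return ('I_(@arity ring_language s) -> R) -> R with
    | RZero => fun=> 0
    | ROne => fun=> 1
    | ROpp => fun a => - a ord0
    | RAdd => fun a => a ord0 + a ord_max
    | RMul => fun a => a ord0 * a ord_max
    end).

Definition group_iso (G H : groupType) : Prop :=
  exists2 phi : G -> H, bijective phi & {morph phi : x y / (x * y)%g}.

(* Only meaningful for commutative [B] and [Z]. *)
Record sym_cocycle (B Z : groupType) : Type := SymCocycle {
  cocycle :> B -> B -> Z;
  cocycleP : forall x y z,
    (cocycle (x * y) z * cocycle x y = cocycle x (y * z) * cocycle y z)%g;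
  cocycle1l : forall x, cocycle 1%g x = 1%g;
  cocycle1r : forall x, cocycle x 1%g = 1%g;
  cocycleC : forall x y, cocycle x y = cocycle y x
}.

Section UnitGroup.
Variable F : fieldType.

Record unit_group : Type := UnitGroup {
  unit_val : F;
  unit_valP : unit_val != 0
}.

HB.instance Definition _ := [isSub for unit_val].
HB.instance Definition _ := [Choice of unit_group by <:].

Lemma unit_mul_subproof (x y : unit_group) : unit_val x * unit_val y != 0.
Proof. by rewrite mulf_neq0 ?unit_valP. Qed.

Lemma unit_inv_subproof (x : unit_group) : (unit_val x)^-1 != 0.
Proof. by rewrite invr_neq0 ?unit_valP. Qed.

Definition unit_one := UnitGroup (oner_neq0 F).
Definition unit_mul x y := UnitGroup (unit_mul_subproof x y).
Definition unit_inv x := UnitGroup (unit_inv_subproof x).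

Lemma unit_mulA : associative unit_mul.
Proof. by move=> x y z; apply: val_inj; rewrite /= mulrA. Qed.
Lemma unit_mul1 : left_id unit_one unit_mul.
Proof. by move=> x; apply: val_inj; rewrite /= mul1r. Qed.
Lemma unit_mulr1 : right_id unit_one unit_mul.
Proof. by move=> x; apply: val_inj; rewrite /= mulr1. Qed.
Lemma unit_mulV : left_inverse unit_one unit_inv unit_mul.
Proof. by move=> x; apply: val_inj; rewrite /= mulVf ?unit_valP. Qed.
Lemma unit_mulrV : right_inverse unit_one unit_inv unit_mul.
Proof. by move=> x; apply: val_inj; rewrite /= mulfV ?unit_valP. Qed.

HB.instance Definition _ :=
  isGroup.Build unit_group unit_mulA unit_mul1 unit_mulr1 unit_mulV unit_mulrV.

Lemma unit_mulC (x y : unit_group) : (x * y = y * x)%g.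
Proof. by apply: val_inj; rewrite /= mulrC. Qed.

End UnitGroup.

Section Triangular.
Variables (F : fieldType) (n : nat).
Implicit Types A B : 'M[F]_n.

Definition upper_trig A : bool :=
  [forall i : 'I_n, forall j : 'I_n, (j < i)%N ==> (A i j == 0)].

Lemma upper_trigP A :
  reflect (forall i j : 'I_n, (j < i)%N -> A i j = 0) (upper_trig A).
Proof.
apply: (iffP forallP) => [h i j ji|h i].
  by move: (h i) => /forallP/(_ j)/implyP/(_ ji)/eqP.
by apply/forallP => j; apply/implyP => ji; rewrite h.
Qed.

Lemma upper_trig_tr A : upper_trig A = is_trig_mx A^T.
Proof.
apply/upper_trigP/is_trig_mxP => h i j ij; first by rewrite mxE h.
by have := h j i ij; rewrite mxE.
Qed.

Lemma upper_trigM A B : upper_trig A -> upper_trig B -> upper_trig (A *m B).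
Proof.
move=> /upper_trigP hA /upper_trigP hB; apply/upper_trigP => i j ji.
rewrite mxE big1 // => k _; case: (ltnP k i) => [ki|ik].
  by rewrite hA ?mul0r.
by rewrite hB ?mulr0 // (leq_trans ji).
Qed.

Lemma upper_trig_diagM A B i :
  upper_trig A -> upper_trig B -> (A *m B) i i = A i i * B i i.
Proof.
move=> /upper_trigP hA /upper_trigP hB.
rewrite mxE (bigD1 i) //= big1 ?addr0 // => k ki.
case: (ltngtP k i) => [lt|gt|eq]; first by rewrite hA ?mul0r.
  by rewrite hB ?mulr0.
by rewrite (val_inj eq) eqxx in ki.
Qed.

Lemma upper_trig_diag_neq0 A i :
  upper_trig A -> A \in unitmx -> A i i != 0.
Proof.
rewrite upper_trig_tr => tA; rewrite unitmxE -det_tr det_trig // unitfE.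
move/prodf_neq0 => /(_ i isT); by rewrite mxE.
Qed.

Lemma upper_trigV A : upper_trig A -> A \in unitmx -> upper_trig (invmx A).
Proof.
move=> tA uA; have nz := upper_trig_diag_neq0 _ tA uA.
move/upper_trigP: (tA) => hA; apply/upper_trigP => i j.
have [m] := ubnP (n - i); elim: m => // m IH in i *; rewrite ltnS => lem ji.
have : (A *m invmx A) i j = 0.
  rewrite mulmxV // mxE; case: eqP => // eij; by rewrite eij ltnn in ji.
rewrite mxE (bigD1 i) //= big1 ?addr0 => [|k ki].
  by move/eqP; rewrite mulf_eq0 (negPf (nz i)) => /eqP.
case: (ltngtP k i) => [lt|gt|eq]; first by rewrite hA ?mul0r.
  rewrite IH ?mulr0 ?(ltn_trans ji) // (leq_trans _ lem) //.
  by rewrite ltn_sub2l // ltn_ord.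
by rewrite (val_inj eq) eqxx in ki.
Qed.

Record trig_group : Type := TrigGroup {
  trig_mx :> 'M[F]_n;
  trig_mxP : upper_trig trig_mx && (trig_mx \in unitmx)
}.

HB.instance Definition _ := [isSub for trig_mx].
HB.instance Definition _ := [Choice of trig_group by <:].

Lemma trig_one_subproof :
  upper_trig (1%:M : 'M[F]_n) && ((1%:M : 'M[F]_n) \in unitmx).
Proof.
rewrite unitmx1 andbT; apply/upper_trigP => i j ji; rewrite mxE.
by case: eqP => // eij; rewrite eij ltnn in ji.
Qed.

Lemma trig_mul_subproof (A B : trig_group) :
  upper_trig (A *m B) && (A *m B \in unitmx).
Proof.
case/andP: (trig_mxP A) => tA uA; case/andP: (trig_mxP B) => tB uB.
by rewrite upper_trigM ?unitmx_mul ?uA.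
Qed.

Lemma trig_inv_subproof (A : trig_group) :
  upper_trig (invmx A) && (invmx A \in unitmx).
Proof.
by case/andP: (trig_mxP A) => tA uA; rewrite upper_trigV ?unitmx_inv.
Qed.

Definition trig_one := TrigGroup trig_one_subproof.
Definition trig_mul (A B : trig_group) := TrigGroup (trig_mul_subproof A B).
Definition trig_inv (A : trig_group) := TrigGroup (trig_inv_subproof A).

Lemma trig_mulA : associative trig_mul.
Proof. by move=> x y z; apply: val_inj; rewrite /= mulmxA. Qed.
Lemma trig_mul1 : left_id trig_one trig_mul.
Proof. by move=> x; apply: val_inj; rewrite /= mul1mx. Qed.
Lemma trig_mulr1 : right_id trig_one trig_mul.
Proof. by move=> x; apply: val_inj; rewrite /= mulmx1. Qed.
Lemma trig_mulV : left_inverse trig_one trig_inv trig_mul.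
Proof.
move=> x; apply: val_inj; rewrite /= mulVmx //.
by case/andP: (trig_mxP x).
Qed.
Lemma trig_mulrV : right_inverse trig_one trig_inv trig_mul.
Proof.
move=> x; apply: val_inj; rewrite /= mulmxV //.
by case/andP: (trig_mxP x).
Qed.

HB.instance Definition _ :=
  isGroup.Build trig_group trig_mulA trig_mul1 trig_mulr1 trig_mulV trig_mulrV.

Lemma trig_diagM (A B : trig_group) i : (A * B)%g i i = A i i * B i i.
Proof.
case/andP: (trig_mxP A) => tA _; case/andP: (trig_mxP B) => tB _.
exact: upper_trig_diagM.
Qed.

Lemma trig_diag1 i : (1%g : trig_group) i i = 1.
Proof. by rewrite /= mxE eqxx. Qed.

Lemma trig_diagV (A : trig_group) i : (A^-1)%g i i = (A i i)^-1.
Proof.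
apply: (@mulfI _ (A i i)).
  by case/andP: (trig_mxP A) => tA uA; apply: upper_trig_diag_neq0.
rewrite -trig_diagM mulgV trig_diag1 mulfV //.
by case/andP: (trig_mxP A) => tA uA; apply: upper_trig_diag_neq0.
Qed.

Definition unitriangular (A : trig_group) : bool :=
  [forall i : 'I_n, A i i == 1].

Lemma unitriangularP (A : trig_group) :
  reflect (forall i, A i i = 1) (unitriangular A).
Proof. exact: 'forall_eqP. Qed.

Record unitrig_group : Type := UnitrigGroup {
  unitrig_val :> trig_group;
  unitrig_valP : unitriangular unitrig_val
}.

HB.instance Definition _ := [isSub for unitrig_val].
HB.instance Definition _ := [Choice of unitrig_group by <:].

Lemma unitriangular_closed : group_closed unitriangular.
Proof.
split; first by apply/unitriangularP => i; rewrite trig_diag1.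
move=> A B /unitriangularP hA /unitriangularP hB; apply/unitriangularP => i.
by rewrite trig_diagM trig_diagV hA hB invr1 mulr1.
Qed.

HB.instance Definition _ :=
  SubChoice_isSubGroup.Build trig_group unitriangular unitrig_group
    unitriangular_closed.

Lemma conj_unitrig_subproof (d : trig_group) (u : unitrig_group) :
  unitriangular (d * unitrig_val u * d^-1)%g.
Proof.
apply/unitriangularP => i; rewrite !trig_diagM trig_diagV.
rewrite (unitriangularP _ (unitrig_valP u)) mulr1 mulfV //.
by case/andP: (trig_mxP d) => tA uA; apply: upper_trig_diag_neq0.
Qed.

Definition conj_unitrig d u := UnitrigGroup (conj_unitrig_subproof d u).

(* The diagonal of the paper's matrix [d_i(a)]. *)
Definition diag_entry (i : 'I_n) (a : unit_group F) : 'rV[F]_n :=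
  \row_j if j == i then unit_val a else 1.

Lemma diag_trig_subproof (d : 'rV[F]_n) :
  (forall j, d 0 j != 0) ->
  upper_trig (diag_mx d) && (diag_mx d \in unitmx).
Proof.
move=> nz; apply/andP; split.
  by rewrite upper_trig_tr tr_diag_mx diag_mx_is_trig.
by rewrite unitmxE det_diag unitfE; apply/prodf_neq0 => i _.
Qed.

Lemma diag_entry_neq0 i a j : diag_entry i a 0 j != 0.
Proof. by rewrite mxE; case: ifP; rewrite ?unit_valP ?oner_neq0. Qed.

Definition diag_elt i a : trig_group :=
  TrigGroup (diag_trig_subproof (diag_entry_neq0 i a)).

(* The [n - 1]-fold power of the unit group; the last diagonal entry of the
   embedding below is always [1]. *)
Definition diag_group : groupType := {ffun 'I_n.-1 -> unit_group F}.

Definition diag_embed (b : diag_group) : trig_group :=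
  (\prod_(i < n.-1) diag_elt (widen_ord (leq_pred n) i) (b i))%g.

Lemma diag_embedE (b : diag_group) :
  trig_mx (diag_embed b) =
  diag_mx (\row_j \prod_(i < n.-1)
             diag_entry (widen_ord (leq_pred n) i) (b i) 0 j).
Proof.
rewrite /diag_embed; elim: (index_enum _) => [|i s IH].
  rewrite big_nil /=; apply/matrixP => i j.
  by rewrite !mxE big_nil.
rewrite big_cons /= IH mulmx_diag; congr diag_mx.
by apply/rowP => j; rewrite !mxE big_cons mxE.
Qed.

Lemma diag_embedM (b c : diag_group) :
  diag_embed (b * c)%g = (diag_embed b * diag_embed c)%g.
Proof.
apply: val_inj; rewrite /= !diag_embedE mulmx_diag; congr diag_mx.
apply/rowP => j; rewrite !mxE -big_split; apply: eq_bigr => i _.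
by rewrite !mxE ffunE; case: ifP; rewrite //= mulr1.
Qed.

Lemma diag_embed1 : diag_embed 1%g = 1%g.
Proof. by apply: (mulgI (diag_embed 1%g)); rewrite -diag_embedM !mulg1. Qed.

Lemma conj_unitrigM d u v :
  conj_unitrig d (u * v)%g = (conj_unitrig d u * conj_unitrig d v)%g.
Proof. by apply: val_inj; rewrite /= !mulgA mulgVK. Qed.

Lemma conj_unitrig_mul d d' u :
  conj_unitrig (d * d')%g u = conj_unitrig d (conj_unitrig d' u).
Proof. by apply: val_inj; rewrite /= invgM !mulgA. Qed.

Lemma conj_unitrig1 u : conj_unitrig 1%g u = u.
Proof. by apply: val_inj; rewrite /= invg1 mulg1 mul1g. Qed.

Lemma conj_unitrig_1 d : conj_unitrig d 1%g = 1%g.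
Proof. by apply: val_inj; rewrite /= mulg1 mulgV. Qed.

End Triangular.

(* An alias that also records [f], so that the group law below is selected by
   [f] and does not clash with the direct product of groups. *)
Definition trig_cocycle_group (F : fieldType) (n : nat)
    (f : sym_cocycle (diag_group F n) (unit_group F)) : Type :=
  (unitrig_group F n * (unit_group F * diag_group F n))%type.

Section TrigCocycle.
Variables (F : fieldType) (n : nat).
Variable f : sym_cocycle (diag_group F n) (unit_group F).

Local Notation trig_cocycle_group := (trig_cocycle_group f).

HB.instance Definition _ := Choice.on trig_cocycle_group.

Implicit Types x y : trig_cocycle_group.

Definition tc_one : trig_cocycle_group := (1%g, (1%g, 1%g)).

Definition tc_mul x y : trig_cocycle_group :=
  let: (u1, (z1, b1)) := x in
  let: (u2, (z2, b2)) := y in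
  (u1 * conj_unitrig (diag_embed b1) u2, (z1 * z2 * f b1 b2, b1 * b2))%g.

Definition tc_inv x : trig_cocycle_group :=
  let: (u, (z, b)) := x in
  (conj_unitrig (diag_embed b^-1) u^-1, ((z * f b^-1 b)^-1, b^-1))%g.

Lemma tc_mulA : associative tc_mul.
Proof.
move=> [u1 [z1 b1]] [u2 [z2 b2]] [u3 [z3 b3]]; rewrite /tc_mul.
congr (_, (_, _)); last by rewrite mulgA.
  by rewrite diag_embedM conj_unitrigM conj_unitrig_mul mulgA.
rewrite -!mulgA; congr (_ * (_ * _))%g.
rewrite [RHS]mulgA [X in _ = (X * _)%g]unit_mulC -[RHS]mulgA; congr (_ * _)%g.
by rewrite [LHS]unit_mulC [RHS]unit_mulC cocycleP.
Qed.

Lemma tc_mul1 : left_id tc_one tc_mul.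
Proof.
move=> [u [z b]]; rewrite /= diag_embed1 conj_unitrig1 cocycle1l.
by rewrite !mul1g mulg1.
Qed.

Lemma tc_mulr1 : right_id tc_one tc_mul.
Proof.
by move=> [u [z b]]; rewrite /= conj_unitrig_1 cocycle1r !mulg1.
Qed.

Lemma tc_mulV : left_inverse tc_one tc_inv tc_mul.
Proof.
move=> [u [z b]]; rewrite /tc_mul /tc_inv /tc_one; congr (_, (_, _)).
- by rewrite -conj_unitrigM mulVg conj_unitrig_1.
- by rewrite -mulgA mulVg.
- by rewrite mulVg.
Qed.

Lemma tc_mulrV : right_inverse tc_one tc_inv tc_mul.
Proof.
move=> [u [z b]]; rewrite /tc_mul /tc_inv /tc_one; congr (_, (_, _)).
- by rewrite -conj_unitrig_mul -diag_embedM mulgV diag_embed1 conj_unitrig1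
    mulgV.
- by rewrite [f b^-1%g b]cocycleC [(z * _^-1)%g]unit_mulC -mulgA mulVg.
- by rewrite mulgV.
Qed.

HB.instance Definition _ :=
  isGroup.Build trig_cocycle_group tc_mulA tc_mul1 tc_mulr1 tc_mulV tc_mulrV.

End TrigCocycle.

(* Main.v *)
From HB Require Import structures.
From mathcomp Require Import all_boot all_order all_algebra generic_quotient.
From mathcomp Require Import boolp classical_sets functions filter ring.
Require Import Defs.

Set Implicit Arguments.
Unset Strict Implicit.
Unset Printing Implicit Defensive.

Import Order.TTheory GRing.Theory Num.Theory.

(** The field F is a limit ultrapower of the rationals. Let I be the set of
    sequences of natural numbers with an ultrafilter that makes each coordinate
    exceed any prescribed function of the earlier ones. In the ultrapower K of
    the rationals over I, let F be the subfield of the classes of functions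
    that depend on finitely many coordinates. Skolem functions inherit such a
    dependency, so the theorem of Los holds for F as well: F is elementarily
    equivalent to the rationals, and T_n(F) to T_n of the rationals
    ([limit_power_equiv], [trig_limit_power_equiv]).

    Unlike an ultrapower, F is not saturated. The infinite product of the
    p_l ^ floor(r * l!), where p_l is a prime above the l-th coordinate and l
    runs below the infinite number given by the coordinate 0, is an element
    s(r) of K that depends on all coordinates; but for large l the number r * l!
    is an integer, so s is additive in r up to a factor in F. Hence
    c(r, r') = s(r) s(r') / s(r + r') is a symmetric 2-cocycle of the rational
    line with values in the multiplicative group of F. It gives
    f(b, b') = c(pi b_0, pi b'_0), where pi is a homomorphism from the
    multiplicative group of F to the rationals that maps 2 ^ (i_0)! to 1; it
    exists because the target is divisible ([rational_character]).

    If T_n(F, f) were isomorphic to some T_n(L), then f would be a coboundary: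
    the scalar matrices split off from the diagonal of T_n(L), and the
    isomorphism identifies them with the central subgroup of T_n(F, f)
    ([iso_cobounds]). Then s \o pi could be corrected by factors in F to a
    homomorphism, whose value at the infinitely divisible 2 ^ (i_0)! would have
    all roots. For a root of order (m+1)!, where m bounds the coordinates
    that the factor at 2 ^ (i_0)! depends on, this contradicts the fact that
    the prime p_m enters s(1) with exponent m! ([quasi_hom_no_lift]).

    On the other hand T_n(F, f) and T_n(F) have isomorphic ultrapowers over
    the natural numbers, because the ultrapower of the extension c splits: a
    sequence v of rationals lifts to the sequence of the j!-th powers of the
    lifts of v_j / j!, and these lifts are additive up to infinitely divisible
    elements of the ultrapower of F, an error that an injectivity argument
    removes ([hom_extension], [rat_line_ultra_split]). So the two groups are
    elementarily equivalent ([cocycle_group_equiv]). *)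

Local Open Scope classical_set_scope.
Local Open Scope ring_scope.

(** * Large sets and transfer of first-order truth *)

Section UltraFilterLogic.
Variables (I : Type) (W : set_system I) (UW : UltraFilter W).

Lemma ultraN (A : set I) : W (~` A) <-> ~ W A.
Proof.
split=> [WnA WA|nWA]; last by case: (in_ultra_setVsetC A UW).
have : W (A `&` ~` A) by exact: filterI.
by rewrite setICr; apply: filter_not_empty.
Qed.

Lemma ultraI (A B : set I) : W (A `&` B) <-> W A /\ W B.
Proof.
split=> [WAB|[WA WB]]; last exact: filterI.
by split; apply: filterS WAB => i [].
Qed.

Lemma filter_iff (A B : set I) : W [set i | A i <-> B i] -> W A <-> W B.
Proof.
by move=> WAB; split=> WA; apply: filterS (filterI WAB WA) => i [AB ?];
  apply/AB.
Qed.

Lemma filter_forall_fin (T : finType) (A : T -> set I) :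
  (forall t, W (A t)) -> W [set i | forall t, A t i].
Proof.
move=> WA.
suff H : forall s : seq T, W [set i | forall t, t \in s -> A t i].
  by move: (H (enum T)); apply: filterS => i Ai t; apply: Ai; rewrite mem_enum.
elim=> [|t s IH]; first exact: filterE.
apply: filterS (filterI (WA t) IH) => i [At As] u.
by rewrite inE => /orP[/eqP->|/As].
Qed.

End UltraFilterLogic.

(** The truncations [trunc k] present the index set as a tower of quotients;
    functions that factor through a stage of the tower form a limit ultrapower.
    With all truncations equal to the identity the limit ultrapower is the
    whole ultrapower. *)
Record index_system : Type := IndexSystem {
  index :> Type;
  large : set_system index;
  large_ultra : UltraFilter large;
  trunc : nat -> index -> index;
  trunc_trunc : forall k l i, (k <= l)%N -> trunc k (trunc l i) = trunc k i
}.
#[local] Existing Instance large_ultra.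

Definition dep (S : index_system) (T : Type) (k : nat) (a : S -> T) : Prop :=
  forall i, a (trunc k i) = a i.

Definition bounded (S : index_system) (T : Type) (a : S -> T) : Prop :=
  exists k, dep k a.

Section Dependency.
Variable S : index_system.

Lemma dep_leq T k l (a : S -> T) : (k <= l)%N -> dep k a -> dep l a.
Proof. by move=> kl da i; rewrite -da trunc_trunc // da. Qed.

Lemma dep_comp T T' k (g : T -> T') (a : S -> T) :
  dep k a -> dep k (fun i => g (a i)).
Proof. by move=> da i; rewrite da. Qed.

Lemma dep_trunc T k (a : S -> T) : dep k (fun i => a (trunc k i)).
Proof. by move=> i; rewrite trunc_trunc. Qed.

Lemma bounded_cst T (x : T) : @bounded S T (fun=> x).
Proof. by exists 0%N. Qed.

Lemma bounded_comp T T' (g : T -> T') (a : S -> T) :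
  bounded a -> bounded (fun i => g (a i)).
Proof. by move=> [k da]; exists k; apply: dep_comp. Qed.

Lemma bounded_comp2 T T' T'' (g : T -> T' -> T'') (a : S -> T) (b : S -> T') :
  bounded a -> bounded b -> bounded (fun i => g (a i) (b i)).
Proof.
move=> [k da] [l db]; exists (maxn k l) => i.
by rewrite (dep_leq (leq_maxl _ _) da) (dep_leq (leq_maxr _ _) db).
Qed.

Lemma bounded_fin (A : finType) T (a : A -> S -> T) :
  (forall x, bounded (a x)) -> exists k, forall x, dep k (a x).
Proof.
move=> /choice[k dk]; exists (\max_x k x)%N => x.
by apply: dep_leq (dk x); apply: leq_bigmax.
Qed.

(** This is where limit ultrapowers obey the theorem of Los: an arbitrary choice
    of witnesses, evaluated after truncation, is still a choice of witnesses,
    because the environment does not change under the truncation. *)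
Lemma bounded_witness (L : language) (M : model L) k (e : nat -> S -> M) x p :
  (forall y, dep k (e y)) ->
  @large S [set i | exists m, holds (update (fun y => e y i) x m) p] ->
  exists2 a : S -> M, dep k a &
    @large S [set i | holds (update (fun y => e y i) x (a i)) p].
Proof.
move=> de He.
have [i0 [m0 _]] : exists i, exists m, holds (update (fun y => e y i) x m) p.
  exact: (filter_ex He).
pose Q i m := (exists m, holds (update (fun y => e y i) x m) p) ->
  holds (update (fun y => e y i) x m) p.
have /choice[c cP] i : exists m, Q i m.
  have [[m Hm]|nex] := pselect (exists m, holds (update (e^~ i) x m) p).
    by exists m.
  by exists m0 => /nex.
exists (fun i => c (trunc k i)); first exact: dep_trunc.
apply: filterS He => i Hi /=.
have eT : e^~ (trunc k i) = e^~ i by apply/funext => y; apply: de.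
by have := cP (trunc k i); rewrite /Q eT; apply.
Qed.

End Dependency.

Lemma eval_ext (L : language) (M : model L) (t : term L) (e e' : nat -> M) :
  (forall x, occurs x t -> e x = e' x) -> eval e t = eval e' t.
Proof.
elim: t => [x|s ts IH] /= ee'; first exact: ee'.
by congr interp; apply/funext => i; apply: IH => x xi; apply: ee'; exists i.
Qed.

Lemma holds_ext (L : language) (M : model L) (p : formula L) (e e' : nat -> M) :
  (forall x, free x p -> e x = e' x) -> holds e p <-> holds e' p.
Proof.
elim: p e e' => [t u|q IH|q IHq r IHr|y q IH] e e' /= ee'.
- by rewrite (@eval_ext _ _ t e e') ?(@eval_ext _ _ u e e') // => x xt;
    apply: ee'; [right|left].
- by rewrite (IH e e').
- rewrite (IHq e e') ?(IHr e e') // => x xq; apply: ee'; [by right|by left].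
- suff H a : holds (update e y a) q <-> holds (update e' y a) q.
    by split=> -[a /H]; exists a.
  apply: IH => x xq; rewrite /update; case: eqP => // xy; exact: ee'.
Qed.

(** A relational form of the theorem of Los: [R] matches the bounded functions
    of two limit ultrapowers, as an isomorphism between them would, and neither
    quotient has to be formed. With the one-point system on one side it compares
    a structure with its limit ultrapower; with the same ultrafilter on both
    sides it compares two structures that have isomorphic ultrapowers. *)
Section Transfer.
Variables (S S' : index_system) (L : language) (M N : model L).
Variable R : (S -> M) -> (S' -> N) -> Prop.
Hypothesis R_total : forall a, bounded a -> exists2 b, bounded b & R a b.
Hypothesis R_onto : forall b, bounded b -> exists2 a, bounded a & R a b.
Hypothesis R_eq : forall a b a' b', R a b -> R a' b' ->
  @large S [set i | a i = a' i] <-> @large S' [set j | b j = b' j].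
Hypothesis R_interp : forall s (a : 'I_(arity s) -> S -> M) b,
  (forall i, R (a i) (b i)) ->
  R (fun x => interp (fun i => a i x)) (fun y => interp (fun i => b i y)).

Lemma eval_transfer t (e : nat -> S -> M) (e' : nat -> S' -> N) :
  (forall x, R (e x) (e' x)) ->
  R (fun i => eval (e^~ i) t) (fun j => eval (e'^~ j) t).
Proof. by move=> ee'; elim: t => [x|s ts IH] //=; apply: R_interp. Qed.

Lemma update_swap T (X : Type) (e : nat -> X -> T) x a i :
  (update e x a)^~ i = update (e^~ i) x (a i).
Proof. by apply/funext => y; rewrite /update; case: eqP. Qed.

(** The bounds have to be uniform over all variables: otherwise an environment
    with infinitely many variables could depend on all coordinates, and no
    bounded witness could be chosen. *)
Lemma holds_transfer p (e : nat -> S -> M) (e' : nat -> S' -> N) :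
  (exists k, forall x, dep k (e x)) -> (exists k, forall x, dep k (e' x)) ->
  (forall x, R (e x) (e' x)) ->
  @large S [set i | holds (e^~ i) p] <-> @large S' [set j | holds (e'^~ j) p].
Proof.
have ext (Q : index_system) T k (f : nat -> Q -> T) x a :
    (forall y, dep k (f y)) -> bounded a ->
    exists l, forall y, dep l (update f x a y).
  move=> df [l da]; exists (maxn k l) => y; rewrite /update; case: eqP => _.
    exact: dep_leq (leq_maxr _ _) da.
  exact: dep_leq (leq_maxl _ _) (df y).
have extR e0 e0' x a b : (forall y, R (e0 y) (e0' y)) -> R a b ->
    forall y, R (update e0 x a y) (update e0' x b y).
  by move=> ee ab y; rewrite /update; case: eqP.
elim: p e e' => [t u|q IH|q IHq r IHr|x q IH] e e' de de' ee' /=.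
- by apply: R_eq; apply: eval_transfer.
- by rewrite -!/(~` [set _ | _]) !ultraN (IH e e').
- by rewrite !ultraI (IHq e e') ?(IHr e e').
- case: (de) (de') => [k dk] [k' dk']; split=> H.
    have [a da Ha] := bounded_witness dk H.
    have [b db Rab] := R_total (ex_intro _ k da).
    have/IH : forall y, R (update e x a y) (update e' x b y) by apply: extR.
    move=> /(_ (ext _ _ _ _ _ _ dk (ex_intro _ k da))).
    move=> /(_ (ext _ _ _ _ _ _ dk' db)).
    case=> HH _.
    have: @large S' [set j | holds ((update e' x b)^~ j) q].
      by apply: HH; apply: filterS Ha => i; rewrite /= update_swap.
    by apply: filterS => j /=; rewrite update_swap; exists (b j).
  have [b db Hb] := bounded_witness dk' H.
  have [a da Rab] := R_onto (ex_intro _ k' db).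
  have/IH : forall y, R (update e x a y) (update e' x b y) by apply: extR.
  move=> /(_ (ext _ _ _ _ _ _ dk da)).
  move=> /(_ (ext _ _ _ _ _ _ dk' (ex_intro _ k' db))).
  case=> _ HH; have: @large S [set j | holds ((update e x a)^~ j) q].
    by apply: HH; apply: filterS Hb => i; rewrite /= update_swap.
  by apply: filterS => j /=; rewrite update_swap; exists (a j).
Qed.

Lemma elem_equiv_transfer : elem_equiv M N.
Proof.
move=> p sp.
have cst (e e' : nat -> M) :
    holds e p <-> holds e' p.
  by apply: holds_ext => x /sp.
have cst' (e e' : nat -> N) : holds e p <-> holds e' p.
  by apply: holds_ext => x /sp.
have truth (Q : index_system) (P : Prop) : @large Q [set i | P] <-> P.
  split=> [H|HP]; first by have [] := filter_ex H.
  exact: filterE.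
have H (e : nat -> M) (e' : nat -> N) a b :
  R a b -> bounded a -> bounded b -> holds e p <-> holds e' p.
  move=> Rab [k da] [l db].
  have [] := @holds_transfer p (fun=> a) (fun=> b).
  - by exists k.
  - by exists l.
  - by [].
  move=> H1 H2; rewrite -(truth S (holds e p)) -(truth S' (holds e' p)).
  split=> HH.
    apply: filterS (H1 _) => [j /=|]; first by rewrite (cst' _ e').
    by apply: filterS HH => i /=; rewrite (cst _ e).
  apply: filterS (H2 _) => [j /=|]; first by rewrite (cst _ e).
  by apply: filterS HH => i /=; rewrite (cst' _ e').
split=> Hp e.
  have [a da Rab] := R_onto (bounded_cst S' (e 0%N)).
  have [i _] := filter_ex (@filterT _ (@large S) _).
  by rewrite -(H (fun=> a i) e _ _ Rab da (bounded_cst _ _)); apply: Hp.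
have [b db Rab] := R_total (bounded_cst S (e 0%N)).
have [i _] := filter_ex (@filterT _ (@large S') _).
by rewrite (H e (fun=> b i) _ _ Rab (bounded_cst _ _) db); apply: Hp.
Qed.

End Transfer.

Lemma elem_equiv_trans (L : language) (M N P : model L) :
  elem_equiv M N -> elem_equiv N P -> elem_equiv M P.
Proof. by move=> MN NP p sp; rewrite (MN p sp); apply: NP. Qed.

Lemma elem_equiv_sym (L : language) (M N : model L) :
  elem_equiv M N -> elem_equiv N M.
Proof. by move=> MN p sp; split=> /(MN p sp). Qed.

(** * The ultrapower of a field and its subfield of bounded classes *)

Section UltraPower.
Variables (S : index_system) (k : fieldType).

Definition ae_eq (a b : S -> k) : bool := `[< large [set i | a i = b i] >].

Lemma ae_eq_refl : reflexive ae_eq.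
Proof. by move=> a; apply/asboolP; exact: filterE. Qed.

Lemma ae_eq_sym : symmetric ae_eq.
Proof.
by move=> a b; apply/asboolP/asboolP; apply: filterS => i /= ->.
Qed.

Lemma ae_eq_trans : transitive ae_eq.
Proof.
move=> b a c /asboolP ab /asboolP bc; apply/asboolP.
by apply: filterS (filterI ab bc) => i [/= -> ->].
Qed.

Canonical ae_eq_equiv := EquivRel ae_eq ae_eq_refl ae_eq_sym ae_eq_trans.

Definition ultrapower : Type := {eq_quot ae_eq}%qT.
HB.instance Definition _ := Choice.on ultrapower.

Definition cls (a : S -> k) : ultrapower := (\pi_({eq_quot ae_eq}) a)%qT.

Lemma cls_eq a b : cls a = cls b <-> large [set i | a i = b i].
Proof.
rewrite /cls; split=> [/eqP|ab]; first by rewrite eqmodE => /asboolP.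
by apply/eqP; rewrite eqmodE; apply/asboolP.
Qed.

Lemma cls_surj (x : ultrapower) : exists a, x = cls a.
Proof. by elim/quotW: x => a; exists a. Qed.

Definition rep (x : ultrapower) : S -> k := projT1 (cid (cls_surj x)).

Lemma repK : cancel rep cls.
Proof. by move=> x; rewrite /rep; case: cid => a /= ->. Qed.

Lemma rep_cls a : large [set i | rep (cls a) i = a i].
Proof. by apply/cls_eq; rewrite repK. Qed.

Definition up_op2 (g : k -> k -> k) x y := cls (fun i => g (rep x i) (rep y i)).
Definition up_op1 (g : k -> k) x := cls (fun i => g (rep x i)).

Lemma up_op2E g a b : up_op2 g (cls a) (cls b) = cls (fun i => g (a i) (b i)).
Proof.
apply/cls_eq; apply: filterS (filterI (rep_cls a) (rep_cls b)).
by move=> i [/= -> ->].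
Qed.

Lemma up_op1E g a : up_op1 g (cls a) = cls (fun i => g (a i)).
Proof. by apply/cls_eq; apply: filterS (rep_cls a) => i /= ->. Qed.

Lemma up_addA : associative (up_op2 +%R).
Proof.
move=> x y z; rewrite -(repK x) -(repK y) -(repK z) !up_op2E.
by congr cls; apply/funext => i; rewrite addrA.
Qed.
Lemma up_addC : commutative (up_op2 +%R).
Proof.
move=> x y; rewrite -(repK x) -(repK y) !up_op2E.
by congr cls; apply/funext => i; rewrite addrC.
Qed.
Lemma up_add0 : left_id (cls (fun=> 0)) (up_op2 +%R).
Proof.
move=> x; rewrite -(repK x) up_op2E.
by congr cls; apply/funext => i; rewrite add0r.
Qed.
Lemma up_addN : left_inverse (cls (fun=> 0)) (up_op1 -%R) (up_op2 +%R).
Proof.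
move=> x; rewrite -(repK x) up_op1E up_op2E.
by congr cls; apply/funext => i; rewrite addNr.
Qed.
HB.instance Definition _ :=
  GRing.isZmodule.Build ultrapower up_addA up_addC up_add0 up_addN.

Lemma up_mulA : associative (up_op2 *%R).
Proof.
move=> x y z; rewrite -(repK x) -(repK y) -(repK z) !up_op2E.
by congr cls; apply/funext => i; rewrite mulrA.
Qed.
Lemma up_mulC : commutative (up_op2 *%R).
Proof.
move=> x y; rewrite -(repK x) -(repK y) !up_op2E.
by congr cls; apply/funext => i; rewrite mulrC.
Qed.
Lemma up_mul1 : left_id (cls (fun=> 1)) (up_op2 *%R).
Proof.
move=> x; rewrite -(repK x) up_op2E.
by congr cls; apply/funext => i; rewrite mul1r.
Qed.
Lemma up_mulD : left_distributive (up_op2 *%R) (up_op2 +%R).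
Proof.
move=> x y z; rewrite -(repK x) -(repK y) -(repK z) !up_op2E.
by congr cls; apply/funext => i; rewrite mulrDl.
Qed.
Lemma up_1_neq0 : cls (fun=> 1) != cls (fun=> 0).
Proof.
apply/eqP => /cls_eq /filter_ex[i /= /eqP].
by rewrite oner_eq0.
Qed.
HB.instance Definition _ :=
  GRing.Zmodule_isComNzRing.Build ultrapower
    up_mulA up_mulC up_mul1 up_mulD up_1_neq0.

Lemma cls0 : cls (fun=> 0) = 0. Proof. by []. Qed.
Lemma cls1 : cls (fun=> 1) = 1. Proof. by []. Qed.
Lemma clsD a b : cls a + cls b = cls (fun i => a i + b i).
Proof. exact: up_op2E. Qed.
Lemma clsN a : - cls a = cls (fun i => - a i).
Proof. exact: up_op1E. Qed.
Lemma clsM a b : cls a * cls b = cls (fun i => a i * b i).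
Proof. exact: up_op2E. Qed.

Lemma up_mulV : forall x : ultrapower, x != 0 -> up_op1 GRing.inv x * x = 1.
Proof.
move=> x x0; rewrite -(repK x) up_op1E clsM -cls1; apply/cls_eq.
have : large (~` [set i | rep x i = 0]).
  by apply/ultraN => /cls_eq; rewrite repK cls0 => x00; rewrite x00 eqxx in x0.
by apply: filterS => i /= /eqP; apply: mulVf.
Qed.
Lemma up_inv0 : up_op1 GRing.inv 0 = 0 :> ultrapower.
Proof. by rewrite -cls0 up_op1E; congr cls; apply/funext => i;
  rewrite invr0. Qed.
HB.instance Definition _ :=
  GRing.ComNzRing_isField.Build ultrapower up_mulV up_inv0.

Lemma clsV a : (cls a)^-1 = cls (fun i => (a i)^-1).
Proof. exact: up_op1E. Qed.

Lemma clsX a m : cls a ^+ m = cls (fun i => a i ^+ m).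
Proof.
elim: m => [|m IH]; first by rewrite expr0 -cls1.
by rewrite exprS IH clsM; congr cls; apply/funext => i; rewrite exprS.
Qed.

Lemma cls_neq0 a : cls a != 0 <-> large [set i | a i != 0].
Proof.
rewrite -cls0; split=> [/eqP H|H].
  have : large (~` [set i | a i = 0]) by apply/ultraN => /cls_eq.
  by apply: filterS => i /= /eqP.
apply/eqP => /cls_eq; apply/ultraN.
by apply: filterS H => i /= /eqP.
Qed.

Definition bounded_cls : {pred ultrapower} :=
  fun x => `[< exists2 a, bounded a & x = cls a >].

Lemma bounded_clsP x :
  reflect (exists2 a, bounded a & x = cls a) (x \in bounded_cls).
Proof. exact: asboolP. Qed.

Lemma bounded_cls_divring : divring_closed bounded_cls.
Proof.
split.
- by apply/bounded_clsP; exists (fun=> 1) => //; apply: bounded_cst.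
- move=> _ _ /bounded_clsP[a ba ->] /bounded_clsP[b bb ->].
  apply/bounded_clsP; rewrite clsN clsD; exists (fun i => a i - b i) => //.
  exact: (bounded_comp2 (fun x y => x - y)).
- move=> _ _ /bounded_clsP[a ba ->] /bounded_clsP[b bb ->].
  apply/bounded_clsP; rewrite clsV clsM; exists (fun i => a i / b i) => //.
  exact: (bounded_comp2 (fun x y => x / y)).
Qed.
HB.instance Definition _ :=
  GRing.isDivringClosed.Build ultrapower bounded_cls bounded_cls_divring.

Record limit_power : Type := LimitPower {
  limit_val :> ultrapower;
  limit_valP : limit_val \in bounded_cls
}.
HB.instance Definition _ := [isSub for limit_val].
HB.instance Definition _ := [Choice of limit_power by <:].
HB.instance Definition _ :=
  [SubChoice_isSubIntegralDomain of limit_power by <:].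
HB.instance Definition _ := [SubIntegralDomain_isSubField of limit_power by <:].

End UltraPower.

(** * Limit ultrapowers of fields and of triangular groups *)

Definition full_system (I : Type) (U : set_system I) (UU : UltraFilter U) :=
  @IndexSystem I U UU (fun _ i => i) (fun _ _ _ _ => erefl).

Lemma bounded_full I U UU T (a : @full_system I U UU -> T) : bounded a.
Proof. by exists 0%N. Qed.

Definition point_system := full_system (principal_filter_ultra tt).

Lemma large_point (A : set unit) : @large point_system A <-> A tt.
Proof. by rewrite /=; split=> /principal_filterP. Qed.

Section LimitPower.
Variables (S : index_system) (k : fieldType).
Local Notation K := (ultrapower S k).
Local Notation F := (limit_power S k).
Local Notation val := (@limit_val S k).

Lemma limit_val_inj : injective val. Proof. exact: val_inj. Qed.
Lemma limit_val0 : val 0 = 0. Proof. exact: (rmorph0 \val). Qed.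
Lemma limit_val1 : val 1 = 1. Proof. exact: (rmorph1 \val). Qed.
Lemma limit_valN x : val (- x) = - val x. Proof. exact: (rmorphN \val). Qed.
Lemma limit_valD x y : val (x + y) = val x + val y.
Proof. exact: (rmorphD \val). Qed.
Lemma limit_valM x y : val (x * y) = val x * val y.
Proof. exact: (rmorphM \val). Qed.

Definition limit_cls (a : S -> k) (ba : bounded a) : F :=
  LimitPower (introT (bounded_clsP (cls a)) (ex_intro2 _ _ a ba erefl)).

Lemma limit_power_equiv : elem_equiv (ring_model k) (ring_model F).
Proof.
pose R (a : S -> k) (b : point_system -> F) := cls a = val (b tt).
apply: (@elem_equiv_transfer S point_system _ (ring_model k) (ring_model F) R).
- by move=> a ba; exists (fun=> limit_cls ba) => //; apply: bounded_full.
- move=> b _; have /bounded_clsP[a ba ab] := limit_valP (b tt).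
  by exists a.
- move=> a b a' b'; rewrite /R large_point /= => ab a'b'.
  by rewrite -cls_eq ab a'b'; split=> [/limit_val_inj|->].
- case=> a b Rab; rewrite /R.
  + by rewrite /= cls0; apply/esym/limit_val0.
  + by rewrite /= cls1; apply/esym/limit_val1.
  + by apply: etrans (esym (limit_valN _)); rewrite -Rab clsN.
  + by apply: etrans (esym (limit_valD _ _)); rewrite -!Rab clsD.
  + by apply: etrans (esym (limit_valM _ _)); rewrite -!Rab clsM.
Qed.

End LimitPower.

Section TrigLimitPower.
Variables (S : index_system) (k : fieldType) (n : nat).
Local Notation K := (ultrapower S k).
Local Notation F := (limit_power S k).
Local Notation val := (@limit_val S k).

(** The matrix of classes of the entries of a family of matrices, as a relation,
    since only bounded families have their classes in the subfield. *)
Definition mx_lim (a : S -> 'M[k]_n) (A : 'M[F]_n) : Prop :=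
  forall i j, cls (fun s => a s i j) = val (A i j).

Lemma cls_sum (I : Type) (r : seq I) (a : I -> S -> k) :
  \sum_(i <- r) cls (a i) = cls (fun s => \sum_(i <- r) a i s).
Proof.
elim: r => [|i r IH].
  by rewrite big_nil -cls0; congr cls; apply/funext => s; rewrite big_nil.
by rewrite big_cons IH clsD; congr cls; apply/funext => s; rewrite big_cons.
Qed.

Lemma mx_limM a b A B :
  mx_lim a A -> mx_lim b B -> mx_lim (fun s => a s *m b s) (A *m B).
Proof.
move=> aA bB i j.
rewrite mxE (big_morph val (@limit_valD _ _) (@limit_val0 _ _)).
under eq_bigr do rewrite limit_valM -aA -bB clsM.
by rewrite cls_sum; congr cls; apply/funext => s; rewrite mxE.
Qed.

Lemma mx_lim1 : mx_lim (fun=> 1%:M) 1%:M.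
Proof.
move=> i j; rewrite !mxE; case: eqP => _; first by rewrite limit_val1.
by rewrite limit_val0.
Qed.

Lemma mx_lim_eq a b A B : mx_lim a A -> mx_lim b B ->
  large [set s | a s = b s] <-> A = B.
Proof.
move=> aA bB; split=> [ab|AB].
  apply/matrixP => i j; apply: limit_val_inj; rewrite -aA -bB.
  by apply/cls_eq; apply: filterS ab => s /= ->.
have : large [set s | forall i, forall j, a s i j = b s i j].
  apply: filter_forall_fin => i; apply: filter_forall_fin => j.
  by apply/cls_eq; rewrite aA bB AB.
by apply: filterS => s /= H; apply/matrixP => i j.
Qed.

Lemma mx_lim_total a : bounded a -> exists A, mx_lim a A.
Proof.
move=> ba; exists (\matrix_(i, j)
  limit_cls (bounded_comp (fun M : 'M_n => M i j) ba)).
by move=> i j; rewrite mxE.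
Qed.

Lemma mx_lim_onto A : exists2 a, bounded a & mx_lim a A.
Proof.
have /choice[a aP] (p : 'I_n * 'I_n) :
    exists a : S -> k, bounded a /\ val (A p.1 p.2) = cls a.
  by have /bounded_clsP[a ba E] := limit_valP (A p.1 p.2); exists a.
have [|l dl] := @bounded_fin S _ _ a; first by move=> p; case: (aP p).
exists (fun s => \matrix_(i, j) a (i, j) s).
  by exists l => s; apply/matrixP => i j; rewrite !mxE dl.
move=> i j; have [_ /= ->] := aP (i, j).
by congr cls; apply/funext => s; rewrite mxE.
Qed.

(** Forming T_n commutes with limit ultrapowers: an entrywise class is upper
    triangular and invertible exactly when almost all the matrices are, the
    inverse being the class of the inverses. *)
Lemma trig_limit_power_equiv :
  elem_equiv (group_model (trig_group k n)) (group_model (trig_group F n)).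
Proof.
pose R (a : S -> trig_group k n) (b : point_system -> trig_group F n) :=
  mx_lim (fun s => trig_mx (a s)) (trig_mx (b tt)).
apply: (@elem_equiv_transfer S point_system _ (group_model (trig_group k n))
  (group_model (trig_group F n)) R).
- move=> a ba.
  have [A aA] := mx_lim_total (bounded_comp (@trig_mx k n) ba).
  have [B aB] := mx_lim_total (bounded_comp (fun x => trig_mx x^-1%g) ba).
  have AB : A *m B = 1%:M.
    apply/(mx_lim_eq (mx_limM aA aB) mx_lim1); apply: filterE => s /=.
    by rewrite mulmxV //; case/andP: (trig_mxP (a s)).
  have tA : upper_trig A && (A \in unitmx).
    rewrite (proj1 (mulmx1_unit AB)) andbT; apply/upper_trigP => i j ji.
    apply: limit_val_inj; rewrite -aA limit_val0 -cls0; congr cls.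
    apply/funext => s; case/andP: (trig_mxP (a s)) => /upper_trigP h _.
    exact: h.
  by exists (fun=> TrigGroup tA) => //; apply: bounded_full.
- move=> b _.
  have [a [l dl] ab] := mx_lim_onto (b tt).
  have [c _ cb] := mx_lim_onto (b tt)^-1%g.
  pose g (M : 'M[k]_n) : trig_group k n := insubd (trig_one k n) M.
  exists (fun s => g (a s)); first by exists l; apply: dep_comp.
  move=> i j; rewrite -ab; apply/cls_eq.
  have au : large [set s | a s \in unitmx].
    have : large [set s | a s *m c s = 1%:M].
      apply/(mx_lim_eq (mx_limM ab cb) mx_lim1).
      by rewrite /= mulmxV //; case/andP: (trig_mxP (b tt)).
    by apply: filterS => s /= /mulmx1_unit[].
  have at' : large [set s | upper_trig (a s)].
    have : large [set s | forall i j : 'I_n, (j < i)%N -> a s i j = 0].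
      apply: filter_forall_fin => i'; apply: filter_forall_fin => j'.
      case: ltnP => [ji|_]; last exact: filterE.
      have : cls (fun s => a s i' j') = cls (fun=> 0).
        rewrite ab cls0 -limit_val0; congr val.
        by case/andP: (trig_mxP (b tt)) => /upper_trigP h _; apply: h.
      by move/cls_eq; apply: filterS.
    by apply: filterS => s /= H; apply/upper_trigP.
  apply: filterS (filterI at' au) => s [/= ta ua].
  by rewrite /g [trig_mx _]insubdK // unfold_in ta ua.
- move=> a b a' b'; rewrite /R => ab a'b'; rewrite large_point /=.
  split=> [H|H].
    apply: val_inj; apply/(mx_lim_eq ab a'b').
    by apply: filterS H => s /= ->.
  have : trig_mx (b tt) = trig_mx (b' tt) by rewrite H.
  move/(mx_lim_eq ab a'b'); apply: filterS => s /= E'; exact: val_inj.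
- case=> a b Rab; rewrite /R.
  + exact: mx_lim1.
  + move=> i j.
    have [d _ db] := mx_lim_onto (trig_inv (b ord0 tt)).
    rewrite -[RHS](db i j); apply/cls_eq.
    have : large [set s | (a ord0 s : 'M_n) *m d s = 1%:M].
      apply/(mx_lim_eq (mx_limM (Rab ord0) db) mx_lim1).
      by rewrite /= mulmxV //; case/andP: (trig_mxP (b ord0 tt)).
    apply: filterS => s /= ad; rewrite -[invmx _]mulmx1 -ad mulKmx //.
    by case/andP: (trig_mxP (a ord0 s)).
  + exact: mx_limM (Rab ord0) (Rab ord_max).
Qed.

End TrigLimitPower.

(** * Homomorphisms into divisible abelian groups *)

Definition subgroup (A : zmodType) (P : set A) : Prop :=
  P 0 /\ forall x y, P x -> P y -> P (x - y).

Section Subgroup.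
Variables (A : zmodType) (P : set A) (sP : subgroup P).

Lemma subgroup0 : P 0. Proof. by case: sP. Qed.
Lemma subgroupB x y : P x -> P y -> P (x - y).
Proof. by case: sP => _; apply. Qed.
Lemma subgroupN x : P x -> P (- x).
Proof. by move=> Px; rewrite -sub0r; apply: subgroupB => //;
  exact: subgroup0. Qed.
Lemma subgroupD x y : P x -> P y -> P (x + y).
Proof. by move=> Px Py; rewrite -[y]opprK; apply/subgroupB/subgroupN. Qed.
Lemma subgroupMn x m : P x -> P (x *+ m).
Proof.
move=> Px; elim: m => [|m IH]; first by rewrite mulr0n; exact: subgroup0.
by rewrite mulrS; apply: subgroupD.
Qed.
Lemma subgroupMz x (k : int) : P x -> P (x *~ k).
Proof.
by move=> Px; case: k => m; [exact: subgroupMn|exact/subgroupN/subgroupMn].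
Qed.

End Subgroup.

Section HomExtension.
Variables (A T : zmodType) (D N : set T) (G0 : set (A * T)).
Hypotheses (sD : subgroup D) (sN : subgroup N) (sG0 : subgroup G0).
Hypothesis D_div : forall d m, D d -> exists2 x, D x & N (d - x *+ m.+1).
Hypothesis G0_D : forall a t, G0 (a, t) -> D t.
Hypothesis G0_N : forall t, G0 (0, t) -> N t.

Let partial_hom (G : set (A * T)) : Prop :=
  [/\ subgroup G, G0 `<=` G, forall a t, G (a, t) -> D t
    & forall t, G (0, t) -> N t].

Let max_partial_hom :
  exists2 M, partial_hom M & forall G, partial_hom G -> M `<=` G -> G `<=` M.
Proof.
have G0h : partial_hom G0 by split.
have [] := @Zorn_bigcup (A * T)%type [set G | partial_hom (G `|` G0)].
  move=> F FP Ftot; have [[X0 FX0]|F0] := pselect (F !=set0); last first.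
    rewrite (_ : \bigcup_(_ in _) _ = set0) /= ?set0U //.
    by apply/seteqP; split=> // x [X FX _]; apply: F0; exists X.
  have sub X x : F X -> (X `|` G0) x -> (\bigcup_(Y in F) Y `|` G0) x.
    by move=> FX [Xx|]; [left; exists X|right].
  have one x : (\bigcup_(Y in F) Y `|` G0) x -> exists2 X, F X & (X `|` G0) x.
    by case=> [[X FX Xx]|G0x]; [exists X => //; left|exists X0 => //; right].
  split=> [|||].
  - split=> [|x y /one[X FX Xx] /one[Y FY Yy]].
      by apply: (sub X0) => //; have [[]] := FP _ FX0.
    have two Z : F Z -> (Z `|` G0) x -> (Z `|` G0) y ->
        (\bigcup_(Y in F) Y `|` G0) (x - y).
      move=> FZ Zx Zy; apply: (sub Z) => //; have [sZ _ _ _] := FP _ FZ.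
      exact: subgroupB.
    have [XY|YX] := Ftot _ _ FX FY.
      by apply: (two Y) => //; case: Xx => [/XY|]; [left|right].
    by apply: (two X) => //; case: Yy => [/YX|]; [left|right].
  - by move=> x; right.
  - by move=> a t /one[X FX Xt]; have [_ _ + _] := FP _ FX; apply; exact: Xt.
  - by move=> t /one[X FX Xt]; have [_ _ _] := FP _ FX; apply.
move=> M [hM maxM]; exists (M `|` G0) => // G hG MG x Gx.
apply: contrapT => nMx; apply: (maxM G); last first.
  by rewrite /= setUidl //; case: hG.
by split=> [y My|/(_ x Gx) Mx]; [apply: MG; left|apply: nMx; left].
Qed.

(** Divisible abelian groups are injective. Everything in the target is taken
    modulo the subgroup [N], so that the lemma applies to an ultrapower without
    forming the quotient; [G0] is the graph of the partial homomorphism to be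
    extended. *)
Lemma hom_extension : exists r : A -> T,
  [/\ forall a, D (r a), forall a b, N (r (a + b) - r a - r b)
    & forall a t, G0 (a, t) -> N (r a - t)].
Proof.
have [M [sM G0M MD MN] maxM] := max_partial_hom.
suff /choice[r rM] a : exists t, M (a, t).
  have diff a t t' : M (a, t) -> M (a, t') -> N (t - t').
    move=> Mt Mt'; apply: MN; rewrite -[0](subrr a).
    exact: (subgroupB sM Mt Mt').
  exists r; split=> [a|a b|a t /G0M]; first exact: MD (rM a).
    rewrite -addrA -opprD; apply: diff (rM _) _.
    exact: (subgroupD sM (rM a) (rM b)).
  exact: diff.
apply: contrapT => na.
(* The value x at a has to agree with the partial homomorphism on the multiples
   of a in its domain; these are the multiples of a least one, m a, and x is an
   m-th part of its value. *)
have [x [Dx xP]] : exists x, D x /\ forall (k : int) t,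
    M (a *~ k, t) -> N (t - x *~ k).
  have [[k0 [k0_gt0 [t0 Mt0]]]|none] :=
      pselect (exists m, (0 < m)%N /\ exists t, M (a *+ m, t)); last first.
    exists 0; split=> [|k t Mt]; first exact: subgroup0.
    have k0 : k = 0.
      case: k Mt => [[|m]|m] Mt //; case: none; exists m.+1; split=> //.
        by exists t.
      exists (- t); rewrite -[a *+ _]opprK; exact: (subgroupN sM Mt).
    by move: Mt; rewrite k0 !mulr0z subr0; apply: MN.
  pose Q m := `[< (0 < m)%N /\ exists t, M (a *+ m, t) >].
  have exQ : exists m, Q m by exists k0; apply/asboolP; split => //; exists t0.
  have [m /asboolP[m_gt0 [d Md]] min_m] := ex_minnP exQ.
  have [x Dx Nx] := D_div m.-1 (MD _ _ Md).
  rewrite prednK // in Nx; exists x; split=> // k t Mt.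
  set q := (k %/ m)%Z.
  have Mr : M (a *~ (k %% m)%Z, t - d *~ q).
    have -> : (a *~ (k %% m)%Z, t - d *~ q) = (a *~ k, t) - (a *+ m, d) *~ q.
      have -> : (a *+ m, d) *~ q = ((a *+ m) *~ q, d *~ q).
        by rewrite [LHS]surjective_pairing !raddfMz.
      have -> : a *~ k = (a *+ m) *~ q + a *~ (k %% m)%Z.
        by rewrite {1}(divz_eq k m) mulrzDr mulrC mulrzA.
      by congr (_, _); rewrite /= addrAC subrr add0r.
    by apply: (subgroupB sM) => //; apply: subgroupMz.
  have r0 : (k %% m)%Z = 0.
    have m0 : m%:Z != 0 by rewrite eqz_nat -lt0n.
    have := modz_ge0 k m0; have := ltz_pmod k (m_gt0 : 0 < m%:Z).
    case: (k %% m)%Z Mr => // -[//|r] Mr; rewrite ltz_nat => rm _.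
    have /min_m : Q r.+1 by apply/asboolP; split=> //; exists (t - d *~ q).
    by rewrite leqNgt rm.
  rewrite r0 mulr0z in Mr; have := MN _ Mr => Nt.
  have -> : t - x *~ k = (t - d *~ q) + (d - x *+ m) *~ q.
    have -> : x *~ k = (x *+ m) *~ q.
      by rewrite {1}(divz_eq k m) r0 addr0 mulrC mulrzA.
    by rewrite mulrzBl addrA subrK.
  by apply: (subgroupD sN) => //; apply: subgroupMz.
pose B : set (A * T) := [set p | exists (p' : A * T) (k : int),
  M p' /\ p = (p'.1 + a *~ k, p'.2 + x *~ k)].
have hB : partial_hom B.
  split.
  - split.
      exists 0, 0; split; first exact: subgroup0.
      by rewrite !mulr0z !addr0.
    move=> _ _ [p [k [Mp ->]]] [p' [k' [Mp' ->]]].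
    exists (p - p'), (k - k'); split; first exact: subgroupB.
    rewrite !mulrzBr; congr (_, _) => /=; rewrite opprD !addrA; congr (_ + _).
      by rewrite addrAC.
    by rewrite addrAC.
  - move=> [a' t'] /G0M Mt; exists (a', t'), 0; split => //.
    by rewrite !mulr0z !addr0.
  - move=> a1 t1 [[a' t'] [k [/= Mt [_ ->]]]].
    apply: (subgroupD sD); first exact: MD Mt.
    exact: subgroupMz.
  - move=> t [[a' t'] [k [/= Mt [/eqP + ->]]]].
    rewrite eq_sym addr_eq0 => /eqP a'E.
    have -> : t' + x *~ k = - (- t' - x *~ k) by rewrite opprB opprK addrC.
    apply/(subgroupN sN)/xP; have := subgroupN sM Mt; rewrite a'E.
    by have -> : - (- (a *~ k), t') = (a *~ k, - t') by congr (_, _);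
      rewrite /= opprK.
have Mx : M (a, x).
  apply: (maxM B hB) => [[a' t'] Mt|].
    by exists (a', t'), 0; split=> //; rewrite !mulr0z !addr0.
  exists (0, 0), 1; split; first exact: (subgroup0 sM).
  by rewrite /= !add0r.
by apply: na; exists x.
Qed.

End HomExtension.

(** * Extensions by the rational line split in an ultrapower *)

(** Let [s] be a homomorphism from the rationals to [Y] modulo [Z], that is, an
    extension of the rational line by [Z]. The extension need not split, but its
    ultrapower does when the torsion of [Y] is killed by 2. *)
Section UltraSplit.
Variables (Y : zmodType) (Z : set Y) (s : rat -> Y).
Variables (U : set_system nat) (UU : UltraFilter U).
Hypothesis sZ : subgroup Z.
Hypothesis s_add : forall r r', Z (s (r + r') - s r - s r').
Hypothesis torsion2 : forall y m, y *+ m.+1 = 0 :> Y -> y *+ 2 = 0.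
Hypothesis U_tail : forall m, U [set j | (m <= j)%N].

Let fctMn (f : nat -> Y) m j : (f *+ m) j = f j *+ m.
Proof. by elim: m => [|m IH]; rewrite ?mulr0n // !mulrS -IH. Qed.

Lemma quasi_hom_mulrn r m : Z (s r *+ m - s (r *+ m)).
Proof.
elim: m => [|m IH].
  rewrite !mulr0n sub0r; apply: subgroupN => //.
  have := s_add 0 0; rewrite addr0 subrr sub0r.
  by move/(subgroupN sZ); rewrite opprK.
have -> : s r *+ m.+1 - s (r *+ m.+1) =
    (s r *+ m - s (r *+ m)) - (s (r + r *+ m) - s r - s (r *+ m)).
  rewrite !mulrS [- (_ - s (r *+ m))]opprB [- (_ - s r)]opprB addrA subrK.
  by rewrite addrA [s r *+ m + _]addrC.
exact: subgroupB.
Qed.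

(* Two (k+1)-th parts of the same element differ by torsion, so their doubles
   agree; because of the factor 2 in [D], the quotient D / N is divisible. *)
Let D : set (nat -> Y) :=
  [set t | forall k, U [set j | exists2 z, Z z & t j = z *+ (k.+1 * 2)]].
Let N : set (nat -> Y) := [set t | U [set j | t j = 0]].

Let sD : subgroup D.
Proof.
split=> [k|x y Dx Dy k].
  by apply: filterE => j; exists 0; rewrite ?mul0rn //; apply: subgroup0.
apply: filterS (filterI (Dx k) (Dy k)) => j [[z Zz xz] [z' Zz' yz']].
exists (z - z'); first exact: subgroupB.
by rewrite mulrnBl -xz -yz'.
Qed.

Let sN : subgroup N.
Proof.
split=> [|x y Nx Ny]; first exact: filterE.
apply: filterS (filterI Nx Ny) => j [/= x0 y0].
by rewrite -[LHS]/(x j - y j) x0 y0 subr0.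
Qed.

Let D_div d m : D d -> exists2 x, D x & N (d - x *+ m.+1).
Proof.
move=> Dd.
have /choice[c cP] j : exists z, (exists2 z, Z z & d j = z *+ (m.+1 * 2)) ->
    d j = z *+ (m.+1 * 2).
  have [[z _ dz]|nz] := pselect (exists2 z, Z z & d j = z *+ (m.+1 * 2)).
    by exists z.
  by exists 0 => /nz.
exists (fun j => c j *+ 2) => [k|].
  apply: filterS (filterI (Dd m) (Dd (m.+1 * k.+1).-1)) => j [/cP dc [z Zz dz]].
  exists z => //; apply/subr0_eq.
  rewrite mulrnA -mulrnBl; apply: (torsion2 (m := (m.+1 * 2).-1)).
  rewrite prednK ?muln_gt0 // mulrnBl -dc dz prednK ?muln_gt0 //.
  by rewrite -mulrnA mulnCA mulnA subrr.
apply: filterS (Dd m) => j /cP dc /=.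
rewrite -[LHS]/(d j - ((fun j => c j *+ 2) *+ m.+1) j) fctMn dc.
by rewrite -mulrnA mulnC subrr.
Qed.

(** The sequence h(v) with terms j! s(v_j / j!) lifts v, and is additive up to
    the j!-fold of an element of [Z], which is an error in [D]. Subtracting from
    h a retraction of all sequences onto [D] makes it additive. *)
Lemma rat_line_ultra_split :
  exists sg : (nat -> rat) -> nat -> Y,
  [/\ forall v, U [set j | Z (s (v j) - sg v j)],
      forall v w, U [set j | sg (fun j => v j + w j) j = sg v j + sg w j]
    & forall v w, U [set j | v j = w j] -> U [set j | sg v j = sg w j]].
Proof.
have [] := @hom_extension (nat -> Y) (nat -> Y) D N [set (d, d) | d in D]
  sD sN _ D_div.
- split=> [|_ _ [x Dx <-] [y Dy <-]]; first by exists 0 => //;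
  apply: (subgroup0 sD).
  by exists (x - y) => //; apply: (subgroupB sD).
- by move=> a t [d Dd [_ <-]].
- move=> t [d Dd [d0 <-]]; rewrite d0; exact: (subgroup0 sN).
move=> r [rD radd rid].
have {}radd a b : U [set j | r (a + b) j = r a j + r b j].
  move: (radd a b); apply: filterS => j H; apply/subr0_eq.
  by rewrite opprD addrA; exact: H.
have {}rid d : D d -> U [set j | r d j = d j].
  move=> Dd; move: (rid d d (ex_intro2 _ _ d Dd erefl)); apply: filterS => j H.
  exact/subr0_eq.
pose h (v : nat -> rat) j := s (v j / j`!%:R) *+ j`!.
have hs v j : Z (s (v j) - h v j).
  have := subgroupN sZ (quasi_hom_mulrn (v j / j`!%:R) j`!).
  by rewrite opprB -mulrnAr -mulr_natr mulrA divfK // pnatr_eq0 -lt0n fact_gt0.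
exists (fun v j => h v j - r (h v) j); split=> [v|v w|v w vw].
- apply: filterS (rD (h v) 0%N) => j [z Zz /= ->].
  rewrite opprB addrA addrAC; apply: subgroupD => //.
  exact: subgroupMn.
- pose b := h v + h w; pose d := h (fun j => v j + w j) - b.
  have Dd : D d.
    move=> k; apply: filterS (U_tail (k.+1 * 2)) => j kj.
    have /dvdnP[q jE] : (k.+1 * 2 %| j`!)%N by rewrite dvdn_fact // muln_gt0.
    pose x := v j / j`!%:R; pose y := w j / j`!%:R.
    exists ((s (x + y) - s x - s y) *+ q); first exact: subgroupMn.
    rewrite -mulrnA -jE !mulrnBl -addrA -opprD.
    by rewrite -[LHS]/(h _ j - (h v j + h w j)) /h mulrDl.
  have hE : h (fun j => v j + w j) = d + b by rewrite /d subrK.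
  apply: filterS (filterI (filterI (radd d b) (radd (h v) (h w))) (rid d Dd)).
  move=> j [[r1 r2] r3]; rewrite /= hE r1 r2 r3.
  rewrite -[(d + b) j]/(d j + (h v j + h w j)).
  by rewrite opprD addrACA subrr add0r opprD addrACA.
- pose d := h v - h w.
  have d0 : U [set j | d j = 0].
    apply: filterS vw => j /= vw.
    by rewrite /d -[LHS]/(h v j - h w j) /h vw subrr.
  have Dd : D d.
    by move=> k; apply: filterS d0 => j /= ->; exists 0; rewrite ?mul0rn //;
      apply: subgroup0.
  have hE : h v = d + h w by rewrite /d subrK.
  apply: filterS (filterI (filterI (radd d (h w)) (rid d Dd)) d0).
  move=> j [[/= r1 r2] r3]; rewrite /= hE r1 r2 -[(d + _) j]/(d j + h w j) r3.
  by rewrite !add0r.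
Qed.

End UltraSplit.

(** * The multiplicative group of a field in additive notation *)

Definition logu (k : fieldType) : Type := unit_group k.
HB.instance Definition _ k := Choice.on (logu k).

Section Logu.
Variable k : fieldType.

Lemma logu_addNr : @left_inverse (logu k) _ _ (unit_one k) (@unit_inv k)
  (@unit_mul k).
Proof. exact: unit_mulV. Qed.

HB.instance Definition _ := GRing.isZmodule.Build (logu k)
  (@unit_mulA k) (@unit_mulC k) (@unit_mul1 k) logu_addNr.

Definition uval (x : logu k) : k := unit_val x.

Lemma uval_inj : injective uval. Proof. exact: val_inj. Qed.
Lemma uval_neq0 x : uval x != 0. Proof. exact: unit_valP. Qed.
Lemma uvalD x y : uval (x + y) = uval x * uval y. Proof. by []. Qed.
Lemma uvalN x : uval (- x) = (uval x)^-1. Proof. by []. Qed.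
Lemma uval0 : uval 0 = 1. Proof. by []. Qed.
Lemma uvalMn x m : uval (x *+ m) = uval x ^+ m.
Proof. by elim: m => [|m IH]; rewrite ?mulr0n // mulrS uvalD IH exprS. Qed.

End Logu.

(** * An index set of sequences with rapidly growing coordinates *)

Definition cut (k : nat) (i : nat -> nat) : nat -> nat :=
  fun l => if (l < k)%N then i l else 0%N.

Lemma cut_cut k l i : (k <= l)%N -> cut k (cut l i) = cut k i.
Proof.
move=> kl; apply/funext => x; rewrite /cut; case: ltnP => // xk.
by rewrite (leq_trans xk kl).
Qed.

(** Modulo an ultrafilter that contains these sets, each coordinate is larger
    than every function of the preceding ones. The filter is proper because the
    coordinates of a suitable sequence can be chosen one after the other. *)
Definition fast_filter : set_system (nat -> nat) :=
  [set A | exists G : nat -> (nat -> nat) -> nat,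
    forall i, (forall k, G k (cut k i) <= i k)%N -> A i].

Lemma fast_filter_proper : ProperFilter fast_filter.
Proof.
apply: Build_ProperFilter_ex.
  move=> A [G GA].
  pose fix st k : nat -> nat := if k is k'.+1 then
    fun l => if l == k' then G k' (st k') else st k' l else fun=> 0%N.
  pose i k := st k.+1 k.
  have st_low k l : (k <= l)%N -> st k l = 0%N.
    by elim: k => //= k IH kl; rewrite gtn_eqF //; apply/IH/ltnW.
  have stE k : cut k i = st k.
    elim: k => [|k IH]; apply/funext => l; rewrite /cut //=.
    have := congr1 (fun f => f l) IH; rewrite /cut ltnS.
    case: ltngtP => [//|kl _|-> _].
    - by rewrite st_low // ltnW.
    - by rewrite /i /= eqxx.
  by exists i; apply: GA => k; rewrite stE /i /= eqxx.
split.
- by exists (fun _ _ => 0%N).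
- move=> A B [G GA] [H HB]; exists (fun k i => maxn (G k i) (H k i)) => i GH.
  by split; [apply: GA|apply: HB] => k; apply: leq_trans (GH k);
    rewrite ?leq_maxl ?leq_maxr.
- by move=> A B AB [G GA]; exists G => i /GA/AB.
Qed.

Definition fast_ultra := projT1 (cid (ultraFilterLemma fast_filter_proper)).

Lemma fast_ultra_ultra : UltraFilter fast_ultra.
Proof. by rewrite /fast_ultra; case: cid => ? []. Qed.

Lemma fast_ultra_ge : fast_filter `<=` fast_ultra.
Proof. by rewrite /fast_ultra; case: cid => ? []. Qed.

Definition fast_system := IndexSystem fast_ultra_ultra cut_cut.

#[local] Instance large_fast_ultra :
  @UltraFilter (nat -> nat) (@large fast_system) := fast_ultra_ultra.

Lemma large_fast k (G : (nat -> nat) -> nat) :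
  @large fast_system [set i | (G (cut k i) <= i k)%N].
Proof.
apply: fast_ultra_ge; exists (fun l => if l == k then G else fun=> 0%N) => i H.
by have := H k; rewrite eqxx.
Qed.

(** * A quasi-homomorphism from the rationals that does not lift *)

Definition prime_above (m : nat) : nat := pdiv (m`!.+1).

Lemma prime_aboveP m : prime (prime_above m) /\ (m < prime_above m)%N.
Proof.
have p1 : (1 < m`!.+1)%N by rewrite ltnS fact_gt0.
have pp := pdiv_prime p1; split=> //; rewrite ltnNge; apply/negP => pm.
have pf : (prime_above m %| m`!)%N by rewrite dvdn_fact // prime_gt0.
have := pdiv_dvd m`!.+1; rewrite -/(prime_above m) -addn1 dvdn_addr //.
by rewrite dvdn1 => /eqP p1'; rewrite -/(prime_above m) p1' in pp.
Qed.

Definition nth_prime (i : nat -> nat) (l : nat) : rat := (prime_above (i l))%:R.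

Lemma nth_prime_neq0 i l : nth_prime i l != 0.
Proof.
rewrite pnatr_eq0 -lt0n prime_gt0 //; exact: (proj1 (prime_aboveP _)).
Qed.

(** The product stops at the coordinate 0, which is an infinite number: the
    value depends on all coordinates, while omitting finitely many factors
    changes the class by an element of the limit ultrapower. *)
Definition tower (r : rat) (i : nat -> nat) : rat :=
  \prod_(0 <= l < i 0%N) nth_prime i l ^ Num.floor (r * l`!%:R).

Lemma tower_neq0 r i : tower r i != 0.
Proof.
by rewrite /tower prodf_seq_neq0; apply/allP => l _ /=;
  rewrite expfz_neq0 ?nth_prime_neq0.
Qed.

Local Notation K := (ultrapower fast_system rat).
Local Notation F := (limit_power fast_system rat).

Lemma cls_tower_neq0 r : cls (S := fast_system) (tower r) != 0.
Proof. by apply/cls_neq0; apply: filterE => i; apply: tower_neq0. Qed.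

Definition quasi_hom (r : rat) : logu K := UnitGroup (cls_tower_neq0 r).

Lemma uval_quasi_hom r : uval (quasi_hom r) = cls (S := fast_system) (tower r).
Proof. by []. Qed.

Definition bounded_logu : set (logu K) :=
  [set y | uval y \in @bounded_cls fast_system rat].

Lemma bounded_logu_subgroup : subgroup bounded_logu.
Proof.
by split; [exact: rpred1|move=> x y; exact: rpred_div].
Qed.

Lemma fact_clears_denominator (r : rat) l : (`|denq r| <= l)%N ->
  exists z : int, r * l`!%:R = z%:~R.
Proof.
move=> dl.
have /dvdnP[q ->] : (`|denq r| %| l`!)%N by rewrite dvdn_fact // absz_gt0
  denq_neq0.
exists (numq r * q%:Z).
have dE : `|denq r|%N%:R = (denq r)%:~R :> rat by rewrite -[in RHS]absz_denq.
have d0 : (denq r)%:~R != 0 :> rat by rewrite intr_eq0 denq_neq0.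
by rewrite -{1}[r]divq_num_den natrM dE mulrCA divfK // mulrC rmorphM.
Qed.

(** For l at least the denominators of r and r', both r * l! and r' * l! are
    integers, and the floor is additive there; the finitely many factors that
    remain depend on finitely many coordinates. *)
Lemma quasi_hom_add r r' :
  bounded_logu (quasi_hom (r + r') - quasi_hom r - quasi_hom r').
Proof.
apply/bounded_clsP; exists (fun i => tower (r + r') i / tower r i / tower r' i).
  2: by rewrite !uvalD !uvalN !uval_quasi_hom !clsV
    (@clsM fast_system rat (tower _)) clsM.
pose k := maxn `|denq r| `|denq r'|.
exists k.+1 => i /=.
set e := fun l : nat => Num.floor ((r + r') * l`!%:R)
  - Num.floor (r * l`!%:R) - Num.floor (r' * l`!%:R).
have e0 l : (k <= l)%N -> e l = 0.
  rewrite geq_max => /andP[].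
  move=> /fact_clears_denominator[z rz] /fact_clears_denominator[z' rz'].
  by rewrite /e mulrDl rz rz' -rmorphD !intrKfloor addrAC addrK subrr.
have E (j : nat -> nat) : tower (r + r') j / tower r j / tower r' j =
    \prod_(0 <= l < j 0%N) nth_prime j l ^ e l.
  rewrite /tower -!prodfV -!big_split; apply: eq_bigr => l _ /=.
  by rewrite !invr_expz -!expfzDr ?nth_prime_neq0.
rewrite !E {1}/cut ltnS leq0n; apply: eq_bigr => l _.
rewrite /nth_prime /cut ltnS; case: leqP => // /ltnW/e0 ->.
by rewrite !expr0z.
Qed.

Lemma large_first k : @large fast_system [set i | (k <= i 0)%N].
Proof. exact: (large_fast 0 (fun=> k)). Qed.

(** The class of [two_root 0] is 2 to the power of an infinite factorial, so it
    has roots of all orders k!, namely the classes of [two_root k]. *)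
Definition two_root (k : nat) (i : nat -> nat) : rat :=
  2 ^+ ((i 0%N)`! %/ k`!).

Lemma two_root_bounded k : bounded (S := fast_system) (two_root k).
Proof. by exists 1%N => i. Qed.

Lemma two_root_neq0 k : limit_cls (two_root_bounded k) != 0.
Proof.
apply/eqP => /(congr1 (@limit_val _ _)) /eqP; rewrite limit_val0; apply/negP.
by apply/cls_neq0; apply: filterE => i; apply: expf_neq0.
Qed.

Definition utwo_root k : logu F := UnitGroup (two_root_neq0 k).

Lemma limit_utwo_root k :
  limit_val (uval (utwo_root k)) = cls (S := fast_system) (two_root k).
Proof. by []. Qed.

Lemma limit_valX m (x : F) : limit_val (x ^+ m) = limit_val x ^+ m.
Proof. exact: (rmorphXn \val). Qed.

Lemma utwo_rootK k : utwo_root k *+ k`! = utwo_root 0.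
Proof.
apply: uval_inj; rewrite uvalMn; apply: limit_val_inj.
rewrite limit_valX /= clsX; apply/cls_eq.
apply: filterS (large_first k) => i /= ki.
by rewrite /two_root fact0 divn1 -exprM divnK // (fact_split ki) dvdn_mulr.
Qed.

Lemma utwo_root_free m : utwo_root 0 *+ m.+1 != 0.
Proof.
apply/eqP => /(congr1 (fun x => limit_val (uval x))).
rewrite uvalMn limit_valX limit_utwo_root clsX uval0 limit_val1 -cls1.
move=> /cls_eq.
move=> /filter_ex[i /= /eqP]; rewrite -exprM.
by apply/negP; rewrite gt_eqF // exprn_egt1 // -lt0n muln_gt0 fact0 divn1
  fact_gt0.
Qed.

(** The group of rationals being divisible, the homomorphism that maps [x] to 1
    extends from the infinite cyclic group that [x] generates. *)
Lemma rational_character (A : zmodType) (x : A) :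
  (forall m, x *+ m.+1 != 0) ->
  exists2 f : A -> rat, {morph f : a b / a + b} & f x = 1.
Proof.
move=> xfree.
pose G0 : set (A * rat) := [set p | exists k : int, p = (x *~ k, k%:~R)].
have [] := @hom_extension A rat setT [set 0] G0.
- by [].
- by split=> // _ _ -> ->; rewrite subr0.
- split=> [|_ _ [k ->] [k' ->]]; first by exists 0; rewrite mulr0z.
  by exists (k - k'); rewrite mulrzBr rmorphB.
- move=> d m _; exists (d / m.+1%:R) => //=.
  by rewrite -[d / _ *+ _]mulr_natr divfK ?subrr // pnatr_eq0.
- by [].
- move=> t [k [/esym/eqP xk ->]].
  case: k xk => [[|m]|m] //; first by rewrite (negPf (xfree m)).
  by rewrite -oppr_eq0 opprK (negPf (xfree m)).
move=> f [_ fD fG]; exists f => [a b|].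
  by apply/subr0_eq; rewrite opprD addrA; apply: fD.
apply/subr0_eq; apply: fG; exists 1.
by rewrite rmorph1.
Qed.

Lemma prime_power_obstruction (p a b : nat) (w d : rat) :
  prime p -> (0 < b)%N -> w != 0 -> (`|numq w| < p)%N -> (`|denq w| < p)%N ->
  w * p%:R ^+ a = d ^+ b -> (b %| a)%N.
Proof.
move=> pp b0 w0 nw dw E.
have cop z : (0 < z < p)%N -> logn p z = 0%N.
  case/andP=> z0 zp; apply/eqP; rewrite -leqn0 leqNgt logn_gt0 mem_primes.
  by rewrite pp z0 /=; apply/negP => /(dvdn_leq z0); rewrite leqNgt zp.
have nw0 : (0 < `|numq w|)%N by rewrite absz_gt0 numq_eq0.
have dw0 : (0 < `|denq w|)%N by rewrite absz_gt0 denq_neq0.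
have dd0 : (0 < `|denq d|)%N by rewrite absz_gt0 denq_neq0.
have d0 : d != 0.
  by apply/eqP => d0; move/eqP: E; rewrite d0 expr0n gtn_eqF // mulf_eq0
    (negPf w0) expf_eq0 pnatr_eq0 gtn_eqF ?andbF // prime_gt0.
have nd0 : (0 < `|numq d|)%N by rewrite absz_gt0 numq_eq0.
have E' : (numq w * p%:Z ^+ a * denq d ^+ b = numq d ^+ b * denq w).
  apply: (@intr_inj rat); rewrite !rmorphM !rmorphXn /=.
  have dwr : (denq w)%:~R != 0 :> rat by rewrite intr_eq0 denq_neq0.
  have ddr : (denq d)%:~R != 0 :> rat by rewrite intr_eq0 denq_neq0.
  apply: (mulIf (invr_neq0 dwr)); rewrite mulfK //.
  apply: (mulIf (invr_neq0 (expf_neq0 b ddr))).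
  rewrite -[in RHS]exprVn -[in RHS]exprMn divq_num_den -E.
  transitivity ((numq w)%:~R / (denq w)%:~R * p%:R ^+ a : rat).
    by field; rewrite ?expf_neq0 ?dwr.
  by rewrite divq_num_den.
move/(congr1 absz): E'; rewrite !abszM !abszX => /(congr1 (logn p)).
rewrite !lognM ?muln_gt0 ?expn_gt0 ?nw0 ?dd0 ?nd0 ?(prime_gt0 pp) //.
rewrite !lognX (cop `|numq w|)%N ?nw0 // (cop `|denq w|)%N ?dw0 // absz_nat.
rewrite add0n addn0 (logn_prime _ pp) eqxx muln1 => E''.
by rewrite -(@dvdn_addl (b * logn p `|denq d|)) ?dvdn_mulr // E'' dvdn_mulr.
Qed.

(** For l <= m the number l! / (m+1)! is at most 1 / (m+1), with floor zero; for
    l > m it is an integer. So the (m+1)!-th power of s(1 / (m+1)!) is s(1)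
    without its factors l <= m. *)
Lemma tower_split m (i : nat -> nat) : (0 < m < i 0%N)%N ->
  tower 1 i = (\prod_(0 <= l < m) nth_prime i l ^+ l`!)
    * nth_prime i m ^+ m`! * tower (m.+1`!%:R^-1) i ^+ m.+1`!.
Proof.
case/andP=> m0 mi.
pose k := m.+1.
have f0 : k`!%:R != 0 :> rat by rewrite pnatr_eq0 -lt0n fact_gt0.
have nat_floor l a :
    nth_prime i l ^ Num.floor (a%:R : rat) = nth_prime i l ^+ a.
  by rewrite -[a%:R]/(a%:Z%:~R) intrKfloor.
have E1 l : nth_prime i l ^ Num.floor (1 * l`!%:R : rat) = nth_prime i l ^+ l`!.
  by rewrite mul1r nat_floor.
have low l : (l < k)%N ->
    nth_prime i l ^ Num.floor (k`!%:R^-1 * l`!%:R : rat) = 1.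
  move=> lk.
  suff -> : Num.floor (k`!%:R^-1 * l`!%:R : rat) = 0 by [].
  apply/eqP; rewrite floor_eq add0r mulr_ge0 ?invr_ge0 ?ler0n //=.
  rewrite mulrC ltr_pdivrMr ?ltr0n ?fact_gt0 // mul1r ltr_nat.
  apply: leq_ltn_trans (leq_fact (_ : l <= m)%N) _ => //.
  by rewrite ltn_fact.
have high l : (k <= l)%N ->
    (nth_prime i l ^ Num.floor (k`!%:R^-1 * l`!%:R : rat)) ^+ k`! =
      nth_prime i l ^+ l`!.
  move=> kl; have /dvdnP[q qE] :
    (k`! %| l`!)%N by rewrite (fact_split kl) dvdn_mulr.
  by rewrite qE natrM mulrCA mulVf // mulr1 nat_floor exprM.
rewrite /tower -/k; under eq_bigr do rewrite E1.
rewrite (big_cat_nat (leq0n _) mi) //= big_nat_recr //=; congr (_ * _).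
rewrite [in RHS](big_cat_nat (leq0n _) mi) //= [X in X * _]big1_seq ?mul1r;
  last first.
  by move=> l; rewrite mem_index_iota => lk; apply: low.
rewrite -prodrXl; apply: eq_big_nat => l /andP[kl _].
by rewrite high.
Qed.

Lemma morphMn (A B : zmodType) (f : A -> B) x m :
  {morph f : a b / a + b} -> f (x *+ m) = f x *+ m.
Proof.
move=> fD; elim: m => [|m IH]; last by rewrite !mulrS fD IH.
by apply: (addrI (f 0)); rewrite -fD !mulr0n !addr0.
Qed.

(** A homomorphism [lam] agreeing with [quasi_hom] up to bounded factors sends
    [utwo_root 0] to a (m+1)!-th power; by [tower_split] so is
    w * p ^ m!, where w depends only on the first m coordinates and the prime p
    above the coordinate m divides neither its numerator nor its denominator.
    Then (m+1)! divides m!, which is absurd for m > 0. *)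
Lemma quasi_hom_no_lift (pi : logu F -> rat) (lam : logu F -> logu K) :
  {morph pi : x y / x + y} -> {morph lam : x y / x + y} ->
  pi (utwo_root 0) = 1 ->
  ~ forall x, bounded_logu (lam x - quasi_hom (pi x)).
Proof.
move=> piD lamD pi0 lift.
have lamE x : exists2 a : fast_system -> rat, bounded a &
    uval (lam x) = cls (fun i => a i * tower (pi x) i).
  have /bounded_clsP[a ba aE] := lift x; exists a => //.
  rewrite -(@clsM fast_system rat a (tower _)) -aE -uval_quasi_hom.
  by rewrite -uvalD subrK.
have [a [m' dm'] aE] := lamE (utwo_root 0).
(* m = 0 would give no contradiction, as 0! = 1!. *)
pose m := m'.+1; pose k := m.+1.
have dm : dep m a := dep_leq (leqnSn _) dm'.
have piK : pi (utwo_root k) = k`!%:R^-1.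
  have f0 : k`!%:R != 0 :> rat by rewrite pnatr_eq0 -lt0n fact_gt0.
  apply: (mulIf f0); rewrite mulVf // mulr_natr -(morphMn _ _ piD).
  by rewrite utwo_rootK pi0.
have [d _ dE] := lamE (utwo_root k); rewrite piK in dE; rewrite pi0 in aE.
have E : @large fast_system
    [set i | a i * tower 1 i = (d i * tower (k`!%:R^-1) i) ^+ k`!].
  apply/cls_eq; rewrite -clsX -aE -dE -uvalMn -morphMn //.
  by rewrite utwo_rootK.
have a0 : @large fast_system [set i | a i * tower 1 i != 0].
  by apply/cls_neq0; rewrite -aE uval_neq0.
pose w (i : fast_system) := a i * \prod_(0 <= l < m) nth_prime i l ^+ l`!.
have dw : dep m w.
  move=> i; rewrite /w dm; congr (_ * _); apply: eq_big_nat => l /andP[_ lm].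
  by rewrite /nth_prime /= /cut lm.
have big := large_fast m (fun i => `|numq (w i)| + `|denq (w i)|)%N.
have [i [[/= Ei ai] [bi mi]]] :=
  filter_ex (filterI (filterI E a0) (filterI big (large_first k))).
rewrite /= dw in bi.
have w0 : w i != 0.
  move: ai; rewrite mulf_eq0 negb_or /w => /andP[ai _].
  rewrite mulf_neq0 // prodf_seq_neq0; apply/allP => l _ /=.
  by rewrite expf_neq0 ?nth_prime_neq0.
have [pp pm] := prime_aboveP (i m).
have Ew : w i * nth_prime i m ^+ m`! = d i ^+ k`!.
  apply: (mulIf (expf_neq0 k`! (tower_neq0 (k`!%:R^-1) i))).
  by rewrite -exprMn -Ei (@tower_split m) // /w -!mulrA.
have nw : (`|numq (w i)| < prime_above (i m))%N.
  by apply: leq_ltn_trans pm; apply: leq_trans bi; rewrite leq_addr.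
have dw' : (`|denq (w i)| < prime_above (i m))%N.
  by apply: leq_ltn_trans pm; apply: leq_trans bi; rewrite leq_addl.
have := prime_power_obstruction pp (fact_gt0 k) w0 nw dw' Ew.
move/(dvdn_leq (fact_gt0 _)); rewrite leqNgt => /negP; apply.
by rewrite ltn_fact.
Qed.

(** * Coordinates on the triangular group *)

Section Coordinates.
Variables (k : fieldType) (n : nat).
Local Notation T := (trig_group k n.+1).
Local Notation U := (unitrig_group k n.+1).
Local Notation B := (diag_group k n.+1).

Local Notation lo := (widen_ord (leq_pred n.+1)).

Lemma diag_embed_diag (b : B) j :
  (diag_embed b : 'M_n.+1) j j =
    if insub (val j) is Some i then unit_val (b i) else 1.
Proof.
rewrite diag_embedE mxE eqxx mulr1n mxE.
case: insubP => [i _ ij|]; last first.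
  rewrite -leqNgt => nj; apply: big1 => i _; rewrite mxE.
  by rewrite -val_eqE /= gtn_eqF // (leq_trans (ltn_ord i)).
rewrite (bigD1 i) //= big1 ?mulr1 => [|i' i'i].
  by rewrite mxE -val_eqE /= ij eqxx.
by rewrite mxE -val_eqE /= -ij val_eqE eq_sym (negPf i'i).
Qed.

Lemma diag_embed_lo (b : B) (i : 'I_n) :
  (diag_embed b : 'M_n.+1) (lo i) (lo i) = unit_val (b i).
Proof. by rewrite diag_embed_diag /= valK. Qed.

Lemma diag_embed_max (b : B) : (diag_embed b : 'M_n.+1) ord_max ord_max = 1.
Proof. by rewrite diag_embed_diag insubN //= ltnn. Qed.

Lemma scalar_trig_subproof (z : unit_group k) :
  upper_trig ((unit_val z)%:M : 'M_n.+1) &&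
    (((unit_val z)%:M : 'M_n.+1) \in unitmx).
Proof.
apply/andP; split.
  by apply/upper_trigP => i j ji; rewrite mxE -val_eqE gtn_eqF ?mulr0n.
by rewrite unitmxE det_scalar unitfE expf_neq0 ?unit_valP.
Qed.

Definition scalar_trig z : T := TrigGroup (scalar_trig_subproof z).

Lemma scalar_trigC z (A : T) : (scalar_trig z * A = A * scalar_trig z)%g.
Proof. by apply: val_inj; rewrite /= scalar_mxC. Qed.

Lemma scalar_trigM z z' : scalar_trig (z * z')%g =
  (scalar_trig z * scalar_trig z')%g.
Proof. by apply: val_inj; rewrite /= scalar_mxM. Qed.

(** For the trivial cocycle this is the isomorphism from T_n(F, 1) to T_n(F). *)
Definition coord_mul (u : U) (b : B) (z : unit_group k) : T :=
  (unitrig_val u * diag_embed b * scalar_trig z)%g.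

Lemma coord_mulM u1 b1 z1 u2 b2 z2 :
  (coord_mul u1 b1 z1 * coord_mul u2 b2 z2)%g =
  coord_mul (u1 * conj_unitrig (diag_embed b1) u2)%g (b1 * b2)%g (z1 * z2)%g.
Proof.
rewrite /coord_mul diag_embedM scalar_trigM /=.
rewrite -!mulgA; congr (_ * _)%g; rewrite !mulgA mulgVK -!mulgA;
  congr (_ * _)%g.
by rewrite !mulgA scalar_trigC -!mulgA scalar_trigC -!mulgA scalar_trigC.
Qed.

Lemma coord_mul_diag u b z j :
  (coord_mul u b z : 'M_n.+1) j j = (diag_embed b : 'M_n.+1) j j * unit_val z.
Proof.
rewrite !trig_diagM (unitriangularP _ (unitrig_valP u)) mul1r.
by congr (_ * _); rewrite /= mxE eqxx.
Qed.

Lemma coord_mul_inj u b z u' b' z' : coord_mul u b z = coord_mul u' b' z' ->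
  [/\ u = u', b = b' & z = z'].
Proof.
move=> E; have D j := congr1 (fun A : T => (A : 'M_n.+1) j j) E.
have zE : z = z'.
  by apply: val_inj; have := D ord_max;
    rewrite !coord_mul_diag !diag_embed_max !mul1r.
have bE : b = b'.
  apply/ffunP => i; apply: val_inj; have := D (lo i).
  by rewrite !coord_mul_diag !diag_embed_lo zE => /(mulIf (unit_valP z')).
by split=> //; apply: val_inj; move: E; rewrite zE bE => /mulIg/mulIg.
Qed.

Lemma trig_diag_neq0 (A : T) j : A j j != 0.
Proof. by case/andP: (trig_mxP A) => tA uA; apply: upper_trig_diag_neq0. Qed.

Lemma coord_mul_surj (A : T) : exists u b z, A = coord_mul u b z.
Proof.
pose z := UnitGroup (trig_diag_neq0 A ord_max).
have bz i : A (lo i) (lo i) / unit_val z != 0.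
  by rewrite mulf_neq0 ?invr_neq0 ?trig_diag_neq0.
pose b : B := [ffun i => UnitGroup (bz i)].
pose V : T := (A * (diag_embed b * scalar_trig z)^-1)%g.
have uV : unitriangular V.
  apply/unitriangularP => j; rewrite trig_diagM trig_diagV trig_diagM.
  suff -> : (diag_embed b : 'M_n.+1) j j * (scalar_trig z : 'M_n.+1) j j =
      A j j.
    by rewrite mulfV ?trig_diag_neq0.
  rewrite [(scalar_trig z : 'M_n.+1) j j]mxE eqxx mulr1n diag_embed_diag.
  case: insubP => [i _ ij|].
    have -> : j = lo i by apply: val_inj.
    by rewrite ffunE /= divfK ?trig_diag_neq0.
  rewrite -leqNgt mul1r => nj; suff -> : j = ord_max by [].
  by apply: val_inj; apply/eqP; rewrite eqn_leq /= nj -ltnS ltn_ord.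
exists (UnitrigGroup uV), b, z.
by rewrite /coord_mul /= /V -[RHS]mulgA mulgVK.
Qed.

End Coordinates.

(** * Cocycles that become coboundaries in an ultrapower *)

Lemma full_group_equiv (G H : groupType) (I : Type) (U : set_system I)
    (UU : UltraFilter U) (Th : (I -> G) -> I -> H) :
  (forall a b, U [set i | a i = b i] <-> U [set i | Th a i = Th b i]) ->
  (forall a b, U [set i | Th (fun i => a i * b i)%g i = (Th a i * Th b i)%g]) ->
  (forall b, exists a, Th a = b) ->
  elem_equiv (group_model G) (group_model H).
Proof.
move=> Th_eq ThM Th_surj; pose S := full_system UU.
pose R (a : S -> G) (b : S -> H) := U [set i | Th a i = b i].
have R_mul a b c d : R a c -> R b d ->
  R (fun i => a i * b i)%g (fun i => c i * d i)%g.
  move=> ac bd; apply: filterS (filterI (filterI ac bd) (ThM a b)).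
  by move=> i [[/= <- <-]].
have R_one : R (fun=> 1%g) (fun=> 1%g).
  apply: filterS (ThM (fun=> 1%g) (fun=> 1%g)) => i /=.
  rewrite (_ : (fun=> 1 * 1)%g = (fun=> 1%g)) => [E|].
    by apply: (mulgI (Th (fun=> 1%g) i)); rewrite mulg1 -E.
  by apply/funext => j; rewrite mulg1.
apply: (@elem_equiv_transfer S S _ (group_model G) (group_model H) R).
- move=> a _; exists (Th a); first exact: bounded_full.
  exact: filterE.
- move=> b _; have [a ab] := Th_surj b; exists a; first exact: bounded_full.
  by apply: filterE => i; rewrite ab.
- move=> a b a' b' ab a'b'.
  apply: iff_trans (Th_eq a a') _; apply: filter_iff.
  by apply: filterS (filterI ab a'b') => i [/= -> ->].
- case=> a b Rab.
  + exact: R_one.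
  + have := R_one.
    have := ThM (fun i => (a ord0 i)^-1)%g (a ord0).
    rewrite (_ : (fun i => _ * _)%g = (fun=> 1%g)); last first.
      by apply/funext => i; rewrite mulVg.
    move=> E1 E2; apply: filterS (filterI (filterI E1 E2) (Rab ord0)).
    move=> i [[/= e1 e2] e3]; apply: (mulIg (b ord0 i)).
    by rewrite mulVg -[X in (_ * X)%g]e3 -e1 e2.
  + exact: R_mul.
Qed.

Section CocycleEquiv.
Variables (F : fieldType) (n : nat).
Local Notation B := (diag_group F n.+1).
Local Notation Z := (unit_group F).
Variable f : sym_cocycle B Z.
Variables (I : Type) (U : set_system I) (UU : UltraFilter U).
Variable h : (I -> B) -> I -> Z.
Hypothesis h_eq : forall b c, U [set i | b i = c i] ->
  U [set i | h b i = h c i].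
Hypothesis h_cobound : forall b c,
  U [set i | (f (b i) (c i) * h (fun j => b j * c j) i)%g = (h b i * h c i)%g].

(** The coboundary [h] untwists the ultrapower of T_n(F, f) into that of
    T_n(F). *)
Lemma cocycle_group_equiv :
  elem_equiv (group_model (trig_cocycle_group f))
             (group_model (trig_group F n.+1)).
Proof.
pose Th (a : I -> trig_cocycle_group f) i :=
  coord_mul (a i).1 (a i).2.2 ((a i).2.1 * h (fun j => (a j).2.2) i)%g.
apply: (full_group_equiv (Th := Th) UU).
- move=> a b; split=> ab.
    have hab : U [set i | (a i).2.2 = (b i).2.2].
      by apply: filterS ab => i /= ->.
    apply: filterS (filterI ab (h_eq hab)) => i [/= abi hi].
    by rewrite /Th abi hi.
  have hab : U [set i | (a i).2.2 = (b i).2.2].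
    by apply: filterS ab => i /= /coord_mul_inj[].
  apply: filterS (filterI ab (h_eq hab)) => i [/= /coord_mul_inj[]].
  case: (a i) => u [z c]; case: (b i) => u' [z' c'] /= -> -> + hi.
  by rewrite hi => /mulIg ->.
- move=> a b.
  apply: filterS (h_cobound (fun i => (a i).2.2) (fun i => (b i).2.2)).
  move=> i /= hi; rewrite /Th coord_mulM.
  have -> : (fun j => (a j * b j)%g.2.2) = (fun j => (a j).2.2 * (b j).2.2)%g.
    apply/funext => j; case: (a j) => u [z c]; by case: (b j) => u' [z' c'].
  case: (a i) (b i) hi => u [z c] [u' [z' c']] /= hi.
  congr coord_mul; rewrite -mulgA hi -!mulgA; congr (_ * _)%g.
  by rewrite !mulgA [(z' * _)%g]unit_mulC.
- move=> A.
  have /choice[u /choice[b /choice[z E]]] i := coord_mul_surj (A i).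
  exists (fun i => (u i, ((z i * (h b i)^-1)%g, b i))); apply/funext => i.
  by rewrite /Th /= mulgVK E.
Qed.

End CocycleEquiv.

(** * Isomorphisms with triangular groups *)

Section Transvections.
Variables (k : fieldType) (n : nat).
Local Notation T := (trig_group k n.+2).

Lemma transvection_subproof (i j : 'I_n.+2) : (i < j)%N ->
  upper_trig (1%:M + delta_mx i j : 'M[k]_n.+2) &&
    ((1%:M + delta_mx i j : 'M[k]_n.+2) \in unitmx).
Proof.
move=> ij; have ji : (j == i) = false by rewrite -val_eqE gtn_eqF.
apply/andP; split.
  apply/upper_trigP => a b ba; rewrite !mxE.
  rewrite -val_eqE gtn_eqF // add0r; case: eqP => //= ai; case: eqP => //= bj.
  by move: ba; rewrite ai bj ltnNge ltnW.
have [] // := @mulmx1_unit _ _ (1%:M + delta_mx i j : 'M[k]_n.+2)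
  (1%:M - delta_mx i j).
rewrite mulmxDl !mulmxBr !mulmx1 !mul1mx mul_delta_mx_0 ?ji //.
by rewrite subr0 subrK.
Qed.

Definition transvection i j ij : T := TrigGroup (@transvection_subproof i j ij).

Lemma transvection_unitrig i j ij : unitriangular (@transvection i j ij).
Proof.
apply/unitriangularP => a; rewrite !mxE eqxx /=.
case: eqP => [->|]; rewrite ?addr0 //= -val_eqE ltn_eqF // addr0 //.
Qed.

Section Centralizer.
Variable A : T.
Hypothesis A_comm : forall (i j : 'I_n.+2) (ij : (i < j)%N),
  (A * transvection ij = transvection ij * A)%g.

Let comm_delta (i j : 'I_n.+2) (ij : (i < j)%N) :
  (A : 'M_n.+2) *m delta_mx i j = delta_mx i j *m A.
Proof.
have /(congr1 (@trig_mx _ _)) /= := A_comm ij.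
by rewrite mulmxDr mulmxDl mulmx1 mul1mx => /addrI.
Qed.

Let delta_entry (i j a b : 'I_n.+2) (ij : (i < j)%N) :
  A a i *+ (b == j) = A j b *+ (a == i).
Proof.
have /matrixP/(_ a b) := comm_delta ij; rewrite !mxE.
rewrite (bigD1 i) //= big1 ?addr0 => [|c ci]; last first.
  by rewrite mxE (negPf ci) mulr0.
rewrite (bigD1 j) //= big1 ?addr0 => [|c cj]; last first.
  by rewrite mxE (negPf cj) andbF mul0r.
by rewrite !mxE !eqxx /= andbT mulr_natr mulr_natl.
Qed.

Lemma central_offdiag a b :
  a != b -> (a != ord0) || (b != ord_max) -> A a b = 0.
Proof.
move=> ab /orP[a0|bm].
  have a0' : ((ord0 : 'I_n.+2) < a)%N by rewrite lt0n.
  have := delta_entry ord0 b a0'.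
  by rewrite eqxx [b == a]eq_sym (negPf ab) mulr0n mulr1n => <-.
have bm' : (b < (ord_max : 'I_n.+2))%N.
  by rewrite ltn_neqAle -ltnS ltn_ord andbT; move: bm; rewrite -val_eqE.
by have := delta_entry a ord_max bm'; rewrite eqxx (negPf ab) mulr0n mulr1n.
Qed.

Lemma central_diag a : A a a = A ord0 ord0.
Proof.
have [->//|a0] := eqVneq a ord0.
have a0' : ((ord0 : 'I_n.+2) < a)%N by rewrite lt0n.
by have := delta_entry ord0 a a0'; rewrite !eqxx.
Qed.

Lemma central_scalar (c : diag_group k n.+2) :
  (diag_embed c : 'M_n.+2) ord0 ord0 != 1 ->
  (A * diag_embed c = diag_embed c * A)%g ->
  forall z, unit_val z = A ord0 ord0 -> A = scalar_trig n.+1 z.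
Proof.
move=> c1 Ac z zA; apply: val_inj; apply/matrixP => a b; rewrite /= mxE zA.
have [<-|ab] := eqVneq a b; first by rewrite central_diag.
rewrite mulr0n; have [|] := boolP ((a != ord0) || (b != ord_max)).
  exact: central_offdiag.
rewrite negb_or !negbK => /andP[/eqP -> /eqP ->].
have /(congr1 (fun M : T => (M : 'M_n.+2) ord0 ord_max)) := Ac.
rewrite /= diag_embedE mul_mx_diag mul_diag_mx !mxE.
set dmax := \prod_(i < _) _; set dmin := \prod_(i < _) _ => E.
have dminE : (diag_embed c : 'M_n.+2) ord0 ord0 = dmin.
  by rewrite diag_embedE mxE eqxx mxE.
have dmaxE : 1 = dmax by rewrite -(diag_embed_max c) diag_embedE mxE eqxx mxE.
move/eqP: E; rewrite -dmaxE mulr1 -subr_eq0 -{1}[A _ _]mul1r -mulrBl mulf_eq0.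
by rewrite -dminE subr_eq0 eq_sym (negPf c1) => /eqP.
Qed.

(** Over the field with two elements the centre of T_n contains the
    transvection in the top right corner, besides the scalars; its exponent 2
    tells it apart from the multiplicative group of an infinite field. *)
Lemma central_square : (forall x : k, x != 0 -> x = 1) -> (A * A = 1)%g.
Proof.
move=> k2; have two0 : (1 + 1 : k) = 0.
  by rewrite -[in X in _ + X](k2 (-1)) ?subrr // oppr_eq0 oner_eq0.
pose E : 'M[k]_n.+2 := A ord0 ord_max *: delta_mx ord0 ord_max.
have AE : (A : 'M_n.+2) = 1%:M + E.
  apply/matrixP => a b; rewrite !mxE.
  have [<-|ab] := eqVneq a b.
    rewrite central_diag (k2 (A ord0 ord0)) ?trig_diag_neq0 //.
    by case: eqP => [->|_]; rewrite mulr0 addr0.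
  rewrite add0r; have [|] := boolP ((a != ord0) || (b != ord_max)).
    move=> ab'; rewrite central_offdiag //; move: ab'.
    by case/orP => /negPf ->; rewrite ?andbF mulr0.
  by rewrite negb_or !negbK => /andP[/eqP -> /eqP ->]; rewrite !eqxx mulr1.
apply: val_inj; rewrite /= AE mulmxDl !mulmxDr !mulmx1 mul1mx.
rewrite -scalemxAl -scalemxAr mul_delta_mx_0 // !scaler0 addr0 -addrA.
by rewrite -[E]scale1r -scalerDl two0 scale0r addr0.
Qed.

End Centralizer.
End Transvections.

Section IsoCobounds.
Variables (F L : fieldType) (n : nat).
Local Notation B := (diag_group F n.+2).
Local Notation Z := (unit_group F).
Variable f : sym_cocycle B Z.
Variable mu : Z.
Hypothesis mu2 : (mu * mu != 1)%g.
Local Notation G := (trig_cocycle_group f).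
Local Notation T := (trig_group L n.+2).

Let zc (z : Z) : G := (1%g, (z, 1%g)).

Let zc_central z g : (zc z * g = g * zc z)%g.
Proof.
case: g => u [y b]; rewrite /zc.
congr (_, (_, _)); last by rewrite mul1g mulg1.
  by rewrite /= diag_embed1 conj_unitrig1 conj_unitrig_1 mul1g mulg1.
by rewrite /= cocycle1l cocycle1r !mulg1 unit_mulC.
Qed.

Let zcM z z' : (zc z * zc z')%g = zc (z * z')%g.
Proof.
by congr (_, (_, _)); rewrite /= ?diag_embed1 ?conj_unitrig1 ?cocycle1l ?mulg1.
Qed.

Let zc_inj : injective zc. Proof. by move=> z z' []. Qed.

Let diag_elt_of (b : B) : G := (1%g, (1%g, b)).

Let diag_eltM b c :
  (diag_elt_of b * diag_elt_of c)%g = (zc (f b c) * diag_elt_of (b * c))%g.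
Proof.
congr (_, (_, _)); rewrite /= ?conj_unitrig_1 ?diag_embed1 ?conj_unitrig_1 //.
  by rewrite cocycle1l !mulg1 mul1g.
by rewrite mul1g.
Qed.

(* For a central (u, (z, b)), commuting with (v, (1, 1)) and (1, (1, c)) means
   that u * diag(b) commutes with v and diag(c). So this matrix is scalar, and
   it is the identity because its last diagonal entry is 1. *)
Let central_zc (g : G) : (forall h, g * h = h * g)%g -> exists z, g = zc z.
Proof.
case: g => u [z b] gC; exists z.
have bC c : (diag_embed b * diag_embed c = diag_embed c * diag_embed b)%g.
  rewrite -!diag_embedM; congr diag_embed; apply/ffunP => i.
  by rewrite !ffunE unit_mulC.
pose A : trig_group F n.+2 := (unitrig_val u * diag_embed b)%g.
have A_comm (i j : 'I_n.+2) (ij : (i < j)%N) :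
    (A * transvection F ij = transvection F ij * A)%g.
  pose v := UnitrigGroup (transvection_unitrig F ij).
  have := congr1 fst (gC (v, (1%g, 1%g))); rewrite /= diag_embed1 conj_unitrig1.
  move/(congr1 (@unitrig_val _ _)) => E.
  have {}E : (unitrig_val u *
      (diag_embed b * transvection F ij * (diag_embed b)^-1))%g =
    (transvection F ij * unitrig_val u)%g by [].
  by rewrite /A [RHS]mulgA -E !mulgA mulgVK.
have A_diag c : (A * diag_embed c = diag_embed c * A)%g.
  have := congr1 fst (gC (diag_elt_of c));
    rewrite /= conj_unitrig_1 mulg1 mul1g.
  move/(congr1 (@unitrig_val _ _)) => E.
  have {}E : unitrig_val u =
    (diag_embed c * unitrig_val u * (diag_embed c)^-1)%g by [].
  by rewrite /A -mulgA bC mulgA {1}E mulgVK mulgA.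
have c1 : (diag_embed ([ffun=> mu] : B) : 'M_n.+2) ord0 ord0 != 1.
  rewrite (_ : ord0 = widen_ord (leq_pred n.+2) ord0); last exact: val_inj.
  rewrite diag_embed_lo ffunE; apply: contraNneq mu2 => m1.
  by apply/eqP; apply: val_inj; rewrite /= m1 mulr1.
have A1 : A = coord_mul 1%g 1%g (UnitGroup (trig_diag_neq0 A ord0)).
  rewrite /coord_mul diag_embed1 !mul1g.
  exact: (central_scalar A_comm c1 (A_diag _)).
have : coord_mul u b 1%g = A.
  rewrite /coord_mul -[RHS]mulg1; congr (_ * _)%g.
  exact: val_inj.
by rewrite A1 => /coord_mul_inj[-> -> _].
Qed.

(** Under an isomorphism [phi], the elements [zc z] correspond to the scalar
    matrices over L, and the entry at (0, 0) is a homomorphism from T_n(L) that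
    is injective on scalars. Composed with [phi], it gives a retraction of the
    group of pairs (z, b) onto its subgroup of the z, so the extension by f
    splits. *)
Lemma iso_cobounds : group_iso G T ->
  exists h : B -> Z, forall b c, (f b c * h (b * c) = h b * h c)%g.
Proof.
move=> [phi [psi phiK psiK] phiM].
have phiC z A : (phi (zc z) * A = A * phi (zc z))%g.
  by rewrite -[A]psiK -!phiM zc_central.
have [x x0 x1] : exists2 x : L, x != 0 & x != 1.
  apply: contrapT => nx; have L2 (x : L) : x != 0 -> x = 1.
    by move=> x0; apply/eqP; apply: contrapT => x1; apply: nx; exists x => //;
      apply/negP.
  have := central_square (A := phi (zc mu)) (fun i j ij => phiC _ _) L2.
  rewrite -phiM zcM => E; move: mu2; apply/negP; rewrite negbK;
    apply/eqP/zc_inj.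
  apply: (can_inj phiK); rewrite E.
  have : (phi 1 * phi 1 = phi 1)%g by rewrite -phiM mulg1.
  by rewrite -[X in _ = X -> _]mulg1 => /mulgI.
pose r (g : G) : unit_group L := UnitGroup (trig_diag_neq0 (phi g) ord0).
have rM : {morph r : g h / (g * h)%g}.
  by move=> g h; apply: val_inj; rewrite /= phiM trig_diagM.
pose xc : diag_group L n.+2 := [ffun=> UnitGroup x0].
have xc1 : (diag_embed xc : 'M_n.+2) ord0 ord0 != 1.
  rewrite (_ : ord0 = widen_ord (leq_pred n.+2) ord0); last exact: val_inj.
  by rewrite diag_embed_lo ffunE.
have phi_zc z : phi (zc z) = scalar_trig n.+1 (r (zc z)).
  exact: (central_scalar (fun i j ij => phiC _ _) xc1 (phiC _ _)).
have r_inj z z' : r (zc z) = r (zc z') -> z = z'.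
  by move=> E; apply/zc_inj/(can_inj phiK); rewrite !phi_zc E.
have r_surj y : exists z, r (zc z) = y.
  have [g|z zE] := @central_zc (psi (scalar_trig n.+1 y)).
    by apply: (can_inj phiK); rewrite !phiM psiK scalar_trigC.
  exists z; apply: val_inj; rewrite /= -zE psiK /=.
  by rewrite mxE eqxx.
have /choice[h hP] b := r_surj (r (diag_elt_of b)).
exists h => b c; apply: r_inj.
by rewrite -!zcM !rM !hP -!rM diag_eltM.
Qed.

End IsoCobounds.

(** * A cocycle that splits only in an ultrapower *)

Lemma logu_torsion (x : logu K) m : x *+ m.+1 = 0 -> x *+ 2 = 0.
Proof.
have [a aE] := cls_surj (uval x).
have pow l : x *+ l = 0 <-> @large fast_system [set i | a i ^+ l = 1].
  rewrite -cls_eq cls1 -clsX -aE -uvalMn; split=> [->//|E].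
  exact: uval_inj.
rewrite !pow; apply: filterS => i /= ai.
have : `|a i| ^+ m.+1 = 1 by rewrite -normrX ai normr1.
move/eqP; rewrite pexpr_eq1 // => /eqP a1.
by rewrite -[LHS]ger0_norm ?sqr_ge0 // normrX a1 expr1n.
Qed.

Lemma uemb_subproof (z : logu F) : limit_val (uval z) != 0.
Proof.
by apply/eqP; rewrite -limit_val0 => /limit_val_inj/eqP;
  rewrite (negPf (uval_neq0 z)).
Qed.

Definition uemb (z : logu F) : logu K := UnitGroup (uemb_subproof z).

Lemma uemb_inj : injective uemb.
Proof. by move=> z z' /(congr1 (@uval _))/limit_val_inj/uval_inj. Qed.

Lemma uembD : {morph uemb : z z' / z + z'}.
Proof. by move=> z z'; apply: uval_inj; apply: limit_valM. Qed.

Lemma uemb0 : uemb 0 = 0.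
Proof. by apply: (addrI (uemb 0)); rewrite -uembD !addr0. Qed.

Lemma uemb_bounded z : bounded_logu (uemb z).
Proof. exact: limit_valP. Qed.

Lemma uemb_onto y : bounded_logu y -> exists z, uemb z = y.
Proof.
move=> yb; have z0 : LimitPower yb != 0.
  by apply/eqP => /(congr1 (@limit_val _ _)) /eqP;
    rewrite limit_val0 (negPf (uval_neq0 y)).
by exists (UnitGroup z0); apply: uval_inj.
Qed.

Lemma cocycle_value r r' :
  exists z, uemb z = quasi_hom r + quasi_hom r' - quasi_hom (r + r').
Proof.
apply: uemb_onto; have := subgroupN bounded_logu_subgroup (quasi_hom_add r r').
by rewrite opprB opprB addrCA addrA [X in X - _]addrC.
Qed.

Definition rat_cocycle r r' : logu F := projT1 (cid (cocycle_value r r')).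

Lemma rat_cocycleE r r' :
  uemb (rat_cocycle r r') = quasi_hom r + quasi_hom r' - quasi_hom (r + r').
Proof. exact: projT2 (cid (cocycle_value r r')). Qed.

Lemma rat_cocycleC r r' : rat_cocycle r r' = rat_cocycle r' r.
Proof. by apply: uemb_inj;
  rewrite !rat_cocycleE [r + r']addrC [quasi_hom r + _]addrC. Qed.

Lemma rat_cocycle0 r : rat_cocycle 0 r = 0.
Proof.
apply: uemb_inj; rewrite rat_cocycleE add0r addrK uemb0; apply: uval_inj.
rewrite uval_quasi_hom uval0 -cls1; congr cls; apply/funext => i.
by apply: big1 => l _; rewrite mul0r floor0 expr0z.
Qed.

Lemma rat_cocycleD x y z : rat_cocycle (x + y) z + rat_cocycle x y =
  rat_cocycle x (y + z) + rat_cocycle y z.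
Proof.
apply: uemb_inj; rewrite !uembD !rat_cocycleE [x + (y + z)]addrA.
set a := quasi_hom x; set b := quasi_hom y; set c := quasi_hom z.
set s := quasi_hom (x + y + z); set p := quasi_hom (x + y);
  set q := quasi_hom (y + z).
have -> : p + c - s + (a + b - p) = a + b + c - s.
  by rewrite addrC !addrA subrK.
rewrite [a + q]addrC [RHS]addrC !addrA subrK; congr (_ - _).
by rewrite [RHS]addrC addrA.
Qed.

Section Witness.
Variables (n : nat) (pi : logu F -> rat).
Hypothesis piD : {morph pi : x y / x + y}.
Local Notation B := (diag_group F n.+2).

Let pi0 (b : B) : rat := pi (b ord0).

Let pi0M (b c : B) : pi0 (b * c)%g = pi0 b + pi0 c.
Proof. by rewrite /pi0 ffunE -piD. Qed.

Let pi01 : pi0 1%g = 0.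
Proof. by apply: (addrI (pi0 1%g)); rewrite -pi0M mulg1 addr0. Qed.

Definition witness_fun (b c : B) : unit_group F := rat_cocycle (pi0 b) (pi0 c).

Lemma witness_cocycleP x y z :
  (witness_fun (x * y) z * witness_fun x y =
   witness_fun x (y * z) * witness_fun y z)%g.
Proof. by rewrite /witness_fun !pi0M; apply: rat_cocycleD. Qed.

Lemma witness_1l x : witness_fun 1%g x = 1%g.
Proof. by rewrite /witness_fun pi01; apply: rat_cocycle0. Qed.

Lemma witnessC x y : witness_fun x y = witness_fun y x.
Proof. exact: rat_cocycleC. Qed.

Lemma witness_1r x : witness_fun x 1%g = 1%g.
Proof. by rewrite witnessC witness_1l. Qed.

Definition witness : sym_cocycle B (unit_group F) :=
  SymCocycle witness_cocycleP witness_1l witness_1r witnessC.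

Lemma witness_equiv :
  elem_equiv (group_model (trig_cocycle_group witness))
             (group_model (trig_group F n.+2)).
Proof.
have [U [UU Ule]] := ultraFilterLemma eventually_filter.
have U_tail m : U [set j | (m <= j)%N] by apply: Ule; exists m.
have [sg [sg_bd sgD sg_eq]] := @rat_line_ultra_split (logu K) bounded_logu
  quasi_hom U UU bounded_logu_subgroup quasi_hom_add logu_torsion U_tail.
pose v (b : nat -> B) j := pi0 (b j).
have /choice[h0 h0P] (p : rat * logu K) : exists z : logu F,
    bounded_logu (quasi_hom p.1 - p.2) -> uemb z = quasi_hom p.1 - p.2.
  have [/uemb_onto[z zE]|nb] := pselect (bounded_logu (quasi_hom p.1 - p.2)).
    by exists z.
  by exists 0.
pose h (b : nat -> B) j : unit_group F := h0 (v b j, sg (v b) j).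
have hE b : U [set j | uemb (h b j) = quasi_hom (v b j) - sg (v b) j].
  apply: filterS (sg_bd (v b)) => j H.
  exact: (h0P (v b j, sg (v b) j) H).
apply: (@cocycle_group_equiv F n.+1 witness nat U UU h) => b c.
  move=> bc; have vbc : U [set j | v b j = v c j].
    by apply: filterS bc => j /= bc; rewrite /v bc.
  by apply: filterS (filterI vbc (sg_eq _ _ vbc)) => j [/= v1 s1];
    rewrite /h v1 s1.
pose bc j := (b j * c j)%g.
have vE : v bc = fun j => v b j + v c j by apply/funext => j; apply: pi0M.
apply: filterS (filterI (filterI (hE b) (hE c))
  (filterI (hE bc) (sgD (v b) (v c)))) => j [[hb hc] [hbc sbc]].
have E1 : uemb (h b j) = quasi_hom (v b j) - sg (v b) j := hb.
have E2 : uemb (h c j) = quasi_hom (v c j) - sg (v c) j := hc.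
have E3 : uemb (h bc j) =
    quasi_hom (v b j + v c j) - (sg (v b) j + sg (v c) j).
  have -> : uemb (h bc j) = quasi_hom (v bc j) - sg (v bc) j := hbc.
  by rewrite vE; congr (_ - _); exact: sbc.
have E4 : uemb (witness_fun (b j) (c j)) =
    quasi_hom (v b j) + quasi_hom (v c j) - quasi_hom (v b j + v c j).
  exact: rat_cocycleE.
have E : (witness_fun (b j) (c j) : logu F) + h bc j = (h b j : logu F) + h c j.
  apply: uemb_inj; rewrite !uembD E1 E2 E3 E4 addrA subrK.
  by rewrite opprD addrACA.
exact: E.
Qed.

Lemma witness_not_trig (L : fieldType) : pi (utwo_root 0) = 1 ->
  ~ group_iso (trig_cocycle_group witness) (trig_group L n.+2).
Proof.
move=> pi_two iso.
have mu2 : ((utwo_root 0 : unit_group F) * utwo_root 0 != 1)%g.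
  exact: (utwo_root_free 1).
have [h hP] := iso_cobounds mu2 iso.
pose line (x : logu F) : B := [ffun i => if i == ord0 then x else 1%g].
have lineM x y : line (x + y) = (line x * line y)%g.
  by apply/ffunP => i; rewrite !ffunE; case: eqP; rewrite ?mulg1.
have pi0_line x : pi0 (line x) = pi x by rewrite /pi0 ffunE eqxx.
pose lam x := quasi_hom (pi x) - uemb (h (line x)).
apply: (@quasi_hom_no_lift pi lam piD _ pi_two) => [x y|x]; last first.
  rewrite /lam addrAC subrr add0r.
  exact/(subgroupN bounded_logu_subgroup)/uemb_bounded.
have E : (rat_cocycle (pi x) (pi y) : logu F) + h (line (x + y)) =
    (h (line x) : logu F) + h (line y).
  by rewrite lineM -!pi0_line; apply: hP.
rewrite /lam piD addrACA -opprD -uembD -E uembD rat_cocycleE.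
by rewrite opprD opprB addrA addrCA subrr addr0.
Qed.

End Witness.

Local Close Scope ring_scope.
Local Close Scope classical_set_scope.

Theorem theorem5p15 (n : nat) (hn : 3 <= n) :
  exists (F : fieldType) (f : sym_cocycle (diag_group F n) (unit_group F)),
    [/\ elem_equiv (ring_model F) (ring_model rat),
        elem_equiv (group_model (trig_cocycle_group f))
                   (group_model (trig_group rat n))
      & forall L : fieldType,
          ~ group_iso (trig_cocycle_group f) (trig_group L n)].
Proof.
case: n hn => [|[|n]] // _.
have [pi piD pi_two] := rational_character utwo_root_free.
exists F, (witness n piD); split.
- exact/elem_equiv_sym/limit_power_equiv.
- apply: elem_equiv_trans (witness_equiv n piD) _.
  exact/elem_equiv_sym/trig_limit_power_equiv.
- by move=> L; apply: witness_not_trig.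
Qed.
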